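(* Let $X$ be a continuum, let $\mathcal{P}$ be its cut point pretree and let $T$ be its cut point tree, with the topology whose basis consists of the sets $U(s,A)$. Then the pretree $\mathcal{P}$ is preseparable, and so the cut point tree $T$ of $X$ is a real tree.
   Context: A continuum is a compact connected metric space. A set $C\subset X$ separates nonempty sets $A,B\subset X$ if there are disjoint open subsets $U,V$ of $X\setminus C$ with $A\subset U$, $B\subset V$ and $U\cup V=X\setminus C$; it separates points $a,b$ if it separates $\{a\}$ and $\{b\}$. A point $c\in X$ is a cut point if $\{c\}$ separates two points of $X$. Cut point pretree. For $a,b\in X$ let $(a,b)$ be the set of cut points $c$ of $X$ such that $\{c\}$ separates $a$ from $b$. For $a\neq b$ put $[a,b)=\{a\}\cup(a,b)$, $(a,b]=(a,b)\cup\{b\}$, $[a,b]=\{a,b\}\cup(a,b)$, and put $[a,a)=(a,a]=\emptyset$, $[a,a]=\{a\}$. Define an equivalence relation on $X$: each cut point is equivalent only to itself, and two points $a,b$ that are not cut points are equivalent if $(a,b)=\emptyset$. Let $\mathcal{P}$ be the set of equivalence classes (a cut point is identified with its class). For $x,y\in\mathcal{P}$: a cut point $c$ lies in $(x,y)$ if for some (equivalently any) $a\in x$, $b\in y$ we have $c\in(a,b)$; a class $z\in\mathcal{P}$ that is not a cut point and is distinct from $x,y$ lies in $(x,y)$ if for some (equivalently any) $a\in x$, $b\in y$, $c\in z$ we have $[a,c)\cap(c,b]=\emptyset$. ''$z$ is between $x$ and $y$'' means $z\in(x,y)$. With this relation $\mathcal{P}$ is a pretree: a set with a betweenness relation (written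 $xyz$ for ''$y$ is between $x$ and $z$'') such that (1) $xyx$ never holds; (2) $xzy\Leftrightarrow yzx$; (3) if $y$ is between $x$ and $z$ then $z$ is not between $x$ and $y$; (4) if $xzy$ and $z\neq w$ then $xzw$ or $yzw$. In any pretree, $(x,y)$ denotes the set of elements between $x$ and $y$, $[x,y]=(x,y)\cup\{x,y\}$, and half-open intervals are defined analogously. A pretree is preseparable if for every interval $I$ in it there is a countable set $Q\subset I$ such that every closed interval $J\subset I$ with more than one element meets $Q$. Cut point tree. Distinct $x,y\in\mathcal{P}$ are adjacent if $(x,y)=\emptyset$. Let $T$ be the disjoint union of $\mathcal{P}$ and one copy $I_{x,y}$ of the real open interval $(0,1)$ for each adjacent pair $x,y$ of $\mathcal{P}$, glued in between $x$ and $y$. The betweenness relation of $\mathcal{P}$ is extended to $T$ in the obvious way, so that in $T$ one has $(x,y)=I_{x,y}$ for $x,y$ adjacent in $\mathcal{P}$ (with the usual order on $I_{x,y}$); for $u,v\in\mathcal{P}$, the interval $(u,v)$ of $T$ is the interval $(u,v)$ of $\mathcal{P}$ together with all $I_{x,y}$ for adjacent $x,y\in[u,v]$; and an interval with an endpoint inside some $I_{x,y}$ and the other endpoint outside $I_{x,y}$ passes from the first endpoint along $I_{x,y}$ to the endpoint $x$ or $y$ that lies on the side of the second one and continues from there. For $s\in T$ and $A\subset T$ finite let $U(s,A)=\{t\in T:[s,t]\cap A=\emptyset\}$. Trees. A big arc is a homeomorphic image of a compact connected linearly ordered topological space with more than one point; an arc is a separable big arc. A big tree is a uniquely big-arcwise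 connected topological space. A real tree is a big tree all of whose big arcs are arcs. *)

(* Defs.v *)
From HB Require Import structures.
From mathcomp Require Import all_boot all_order all_algebra.
From mathcomp Require Import all_classical all_reals all_analysis.

Set Implicit Arguments.
Unset Strict Implicit.
Unset Printing Implicit Defensive.

Import Order.TTheory GRing.Theory Num.Theory.
Local Open Scope classical_set_scope.
Local Open Scope ring_scope.

(* A betweenness relation is a ternary relation [B]; [B x z y] reads "z is
   between x and y". *)
Section Intervals.
Context {T : Type} (B : T -> T -> T -> Prop).

Definition pitv_oo (x y : T) : set T := [set z | B x z y].
Definition pitv_co (x y : T) : set T := [set z | x <> y /\ (z = x \/ B x z y)].
Definition pitv_oc (x y : T) : set T := [set z | x <> y /\ (z = y \/ B x z y)].
Definition pitv_cc (x y : T) : set T := [set x; y] `|` pitv_oo x y.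

Definition is_pitv (I : set T) :=
  exists x y, [\/ I = pitv_oo x y, I = pitv_co x y, I = pitv_oc x y |
    I = pitv_cc x y].

Definition preseparable := forall I, is_pitv I ->
  exists Q : set T, [/\ Q `<=` I, countable Q &
    forall u v, pitv_cc u v `<=` I ->
      (exists a b, [/\ pitv_cc u v a, pitv_cc u v b & a <> b]) ->
      pitv_cc u v `&` Q !=set0].

Definition adjacent_in (x y : T) := x <> y /\ pitv_oo x y = set0.

End Intervals.

Section CutPoints.
Context {X : topologicalType}.

Definition rel_open (Y U : set X) := exists2 W, open W & U = Y `&` W.

Definition separates (C A B : set X) :=
  [/\ A !=set0, B !=set0 &
    exists U V : set X,
      [/\ rel_open (~` C) U, rel_open (~` C) V, U `&` V = set0,
          A `<=` U /\ B `<=` V & U `|` V = ~` C]].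

Definition cut_point (c : X) := exists a b, separates [set c] [set a] [set b].

Definition cut_between (a c b : X) :=
  cut_point c /\ separates [set c] [set a] [set b].

Definition cut_equiv (a b : X) :=
  a = b \/ [/\ ~ cut_point a, ~ cut_point b & pitv_oo cut_between a b = set0].

End CutPoints.

(* The points of the cut point pretree are literally the equivalence classes,
   so [\val x : set X] for [x : cut_pretree X]. *)
Definition cut_pretree (X : topologicalType) : Type :=
  set_type (range (fun a : X => [set b | cut_equiv a b])).

HB.instance Definition _ (X : topologicalType) := Choice.on (cut_pretree X).

Section Pretree.
Context {X : topologicalType}.
Implicit Types x y z : cut_pretree X.

Definition is_cut z := exists2 c : X, cut_point c & \val z c.

Definition pbetween x z y :=
     (exists a b c : X, [/\ \val x a, \val y b, \val z c, cut_point c &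
        cut_between a c b])
  \/ [/\ ~ is_cut z, z <> x, z <> y &
      exists a b c : X, [/\ \val x a, \val y b, \val z c &
        pitv_co cut_between a c `&` pitv_oc cut_between c b = set0]].

End Pretree.

(* Adjacent pairs are unordered. *)
Definition edge (X : topologicalType) : Type :=
  set_type [set e : set (cut_pretree X) |
    exists xy, adjacent_in pbetween xy.1 xy.2 /\ e = [set xy.1; xy.2]].

HB.instance Definition _ (X : topologicalType) := Choice.on (edge X).

(* The ends of the copy of the interval ]0, 1[ attached to [e]: [end0 e] is the
   one at parameter 0 and [end1 e] the one at parameter 1. Which of the two
   adjacent elements is which is an arbitrary choice. *)
Definition end0 (X : topologicalType) (e : edge X) : cut_pretree X :=
  (sval (cid (set_valP e))).1.
Definition end1 (X : topologicalType) (e : edge X) : cut_pretree X :=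
  (sval (cid (set_valP e))).2.

Definition unit_itv (R : realType) : Type := set_type (`]0, 1[ : set R).

HB.instance Definition _ (R : realType) := Choice.on (unit_itv R).

Definition cut_tree (R : realType) (X : topologicalType) : Type :=
  (cut_pretree X + edge X * unit_itv R)%type.

HB.instance Definition _ (R : realType) (X : topologicalType) :=
  Choice.on (cut_tree R X).

Section Tree.
Context {R : realType} {X : topologicalType}.
Implicit Types (p q r s : cut_tree R X) (u v : cut_pretree X).

Definition ends p : set (cut_pretree X) :=
  match p with inl x => [set x] | inr (e, _) => \val e end.

(* [u] is the vertex at which the path from [p] to [r] starts travelling in the
   pretree: [p] itself if it is a vertex; otherwise the end of the edge of [p]
   that lies on the side of [r], that is, between [r] and the other end. *)
Definition gate p r u :=
  ends p u /\ forall x w, ends p x -> ends r w -> pitv_cc pbetween w x u.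

(* The points strictly between [p] and the end [u] of the edge of [p]. *)
Definition stub p u : set (cut_tree R X) :=
  match p with
  | inl _ => set0
  | inr (e, t) => [set q | exists2 i : unit_itv R, q = inr (e, i) &
      (u = end0 e /\ \val i < \val t) \/ (u = end1 e /\ \val t < \val i)]
  end.

(* The closed interval of the tree between two vertices. *)
Definition vertex_citv u v : set (cut_tree R X) :=
  [set q | ends q `<=` pitv_cc pbetween u v].

Definition route p q r :=
  [/\ q <> p, q <> r &
    exists u v, [/\ gate p r u, gate r p v &
      (stub p u `|` vertex_citv u v `|` stub r v) q]].

Definition tbetween p q r :=
  match p, r with
  | inr (e, s), inr (e', t) =>
      if e == e' then exists2 i : unit_itv R, q = inr (e, i) &
        (\val s < \val i < \val t) || (\val t < \val i < \val s)
      else route p q r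
  | _, _ => route p q r
  end.

Definition tree_nbhd s (A : set (cut_tree R X)) : set (cut_tree R X) :=
  [set t | pitv_cc tbetween s t `&` A = set0].

Definition tree_basis : set (set (cut_tree R X)) :=
  [set U | exists s A, finite_set A /\ U = tree_nbhd s A].

End Tree.

(* The topology generated by [tree_basis]. If [t] is in U(s,A) then
   U(s,A) = U(t,A), so that U(s,A) `&` U(s',A') = U(t, A `|` A') for every [t]
   in the intersection: [tree_basis] is a basis of this topology. *)
HB.instance Definition _ (R : realType) (X : topologicalType) :=
  @isSubBaseTopological.Build (cut_tree R X) (set (cut_tree R X))
    tree_basis id.

Section Trees.
Context {T : topologicalType}.

Definition separable (S : topologicalType) :=
  exists2 Q : set S, countable Q & dense Q.

Definition homeomorphism (S S' : topologicalType) (f : S -> S') :=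
  continuous f /\
  exists g : S' -> S, [/\ cancel f g, cancel g f & continuous g].

Definition big_arc (A : set T) :=
  exists (d : Order.disp_t) (J : orderTopologicalType d)
         (f : J -> set_type A),
    [/\ compact [set: J], connected [set: J], exists x y : J, x <> y &
        homeomorphism f].

(* The endpoints of a big arc are the images of the least and of the greatest
   element of the ordered space. *)
Definition big_arc_between (A : set T) (p q : T) :=
  exists (d : Order.disp_t) (J : orderTopologicalType d)
         (f : J -> set_type A),
    [/\ compact [set: J], connected [set: J], exists x y : J, x <> y,
        homeomorphism f &
        exists l h : J, [/\ forall x, (l <= x <= h)%O, \val (f l) = p &
          \val (f h) = q]].

Definition is_arc (A : set T) := big_arc A /\ separable (set_type A).

End Trees.

Definition big_tree (T : topologicalType) :=
  forall p q : T, p <> q -> exists! A : set T, big_arc_between A p q.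

Definition real_tree (T : topologicalType) :=
  big_tree T /\ forall A : set T, big_arc A -> is_arc A.

(* Main.v *)
Require Import Defs.
From HB Require Import structures.
From mathcomp Require Import all_boot all_order all_algebra finmap lra.
From mathcomp Require Import all_classical all_reals all_analysis.

(** The points of X separating [a] from [b] are linearly ordered, because a
    clopen part of the complement of one point and a clopen part of the
    complement of another are disjoint as soon as neither contains the point
    defining the other one ([half_disjoint]). This fact alone makes the classes
    of X a pretree ([pint_pretree]).

    The pretree is preseparable because X has a countable basis
    ([dense_cuts]). If an interval has three cut points inside, the middle one
    has a neighbourhood in which the other cut points of the big interval belong
    to the small one, and a countable dense set of cut points meets it. The
    other intervals have two adjacent elements, one of which is a cut point [d];
    the side of [d] containing the other element separates it from all later
    ones, and there are countably many such elements.

    The tree needs two more properties of the pretree: any three elements have a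
    median ([pretree_median]) and the intervals have no gaps
    ([pretree_complete]). Both are consequences of an existence principle
    ([core_point]). Choose a preferred direction at each point of X, in such a
    way that no two points see each other in the direction opposite to the
    preferred one, and remove from X everything that is not in a preferred
    direction. The rest, called the core, is a continuum. If all its points were
    cut points, they would cut off disjoint open sets, so that the core would be
    countable; being connected and metric it would be a single point, and this
    point would separate the directions from which the core is approached. For
    the median of three points, the preferred direction is that of the majority;
    for a gap in an interval, it is the direction of the gap. In both cases the
    core provides the missing element of the pretree.

    On the tree, every edge [e] has a retraction onto it, with values in [0, 1]
    ([coord]), and the intervals of the tree are determined by the intervals of
    the pretree and by these retractions ([tint], [tint_citv]). It follows that
    they satisfy the pretree axioms, have no gaps, have no adjacent elements
    since these are joined by edges, and have countably many edges, so that
    rational points of edges together with countably many vertices are dense.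

    Finally, in any pretree with such intervals and with the topology generated
    by the branches at its points ([interval_real_tree]), the topology of an
    interval is the order topology, so that it is a compact connected ordered
    space. It is the only big arc between its ends [p] and [q], since each point
    between them separates [p] from [q]. *)

Set Implicit Arguments.
Unset Strict Implicit.
Unset Printing Implicit Defensive.
Import Order.TTheory GRing.Theory Num.Theory.
Local Open Scope classical_set_scope.

(** * Pretrees given by closed intervals *)

(** The pretree axioms in terms of closed intervals, where an element is also
    between itself and any other; this spares the distinction between equal and
    strictly between in most arguments. *)
Record interval_pretree (T : Type) (I : T -> T -> set T) : Prop := {
  ipt_refl : forall x z, I x x z -> z = x;
  ipt_left : forall x y, I x y x;
  ipt_sym : forall x y z, I x y z -> I y x z;
  ipt_anti : forall x y z, I x z y -> I x y z -> y = z;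
  ipt_cover : forall x w y z, I x y z -> I x w z \/ I w y z }.

Definition interval_dense (T : Type) (I : T -> T -> set T) :=
  forall p q, p <> q -> exists t, [/\ I p q t, t <> p & t <> q].

Section IntervalPretree.
Context {T : Type} {I : T -> T -> set T} (IP : interval_pretree I).
Implicit Types (a b p q s t u v x y z m : T) (L : set T).

Let rfl := ipt_refl IP.
Let lft := ipt_left IP.
Let sym := ipt_sym IP.
Let anti := ipt_anti IP.
Let cover := ipt_cover IP.

Lemma ipt_right x y : I x y y.
Proof. by apply: sym; exact: lft. Qed.

Lemma ipt_sub x y z : I x y z -> I x z `<=` I x y.
Proof.
move=> xyz w xzw; case: (cover y xzw) => [//|yzw].
case: (cover w xyz) => [xwz|wyz].
  by rewrite (anti xzw xwz).
by rewrite (anti yzw (sym wyz)).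
Qed.

Lemma ipt_sub_r x y z : I x y z -> I z y `<=` I x y.
Proof. by move=> /sym /ipt_sub h w /sym /h /sym. Qed.

Lemma ipt_swap a b v u : I a b v -> I a v u -> I u b v.
Proof.
move=> abv avu; case: (cover u abv) => // auv.
by rewrite (anti avu auv); exact: lft.
Qed.

(** Together with [ipt_anti] and [ipt_sub], this makes [I a v u], read [u <= v],
    a linear order on [a, b]; [ipt_swap] says that it is reversed when the
    interval is read from [b]. *)
Lemma ipt_total a b u v : I a b u -> I a b v -> I a u v \/ I a v u.
Proof.
move=> abu abv; case: (cover v abu) => [|vbu]; first by right.
case: (cover u abv) => [|ubv]; first by left.
have -> : u = v by apply: (@anti b); exact: sym.
by left; exact: ipt_right.
Qed.

Lemma ipt_convex x y u v : I x y u -> I x y v -> I u v `<=` I x y.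
Proof.
move=> xyu xyv; wlog xvu : u v xyu xyv / I x v u.
  move=> H; case: (ipt_total xyu xyv) => h; last exact: H.
  by move=> w /sym; exact: H.
by move=> w uvw; apply: (ipt_sub xyv); apply: (ipt_sub_r xvu).
Qed.

(** The order of [a, b] is [I a t s], read [s <= t]; [m] fills the Dedekind cut
    of which [L] is the lower part. *)
Definition interval_cut a b L m :=
  I a b m /\ forall t, I a b t -> (L t -> I a m t) /\ (~ L t -> I a t m).

Definition initial_segment a b L :=
  forall t s, I a b t -> L t -> I a t s -> L s.

Definition interval_complete a b :=
  forall L, initial_segment a b L -> L a -> ~ L b ->
    exists m, interval_cut a b L m.

Lemma initial_segment_sub a b p q L : I a b q -> I a q p ->
  initial_segment a b L -> initial_segment p q L.
Proof.
move=> abq aqp iL t s pqt Lt pts.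
have aqt : I a q t by exact: (ipt_sub_r aqp).
have abt : I a b t by exact: (ipt_sub abq).
apply: (iL t s abt Lt).
have atp : I a t p by apply: sym; exact: ipt_swap (sym aqp) (sym pqt).
exact: (ipt_sub_r atp).
Qed.

(** A cut is visible on any subinterval that starts in [L] and ends outside:
    this reduces completeness to short pieces of an interval. *)
Lemma interval_cut_local a b p q L m : initial_segment a b L ->
  I a b q -> I a q p -> L p -> ~ L q -> interval_cut p q L m ->
  interval_cut a b L m.
Proof.
move=> iL abq aqp Lp Lq [pqm cm].
have aqm : I a q m by exact: (ipt_sub_r aqp).
have abm : I a b m by exact: (ipt_sub abq).
have abp : I a b p by exact: (ipt_sub abq).
have amp : I a m p by apply: sym; exact: ipt_swap (sym aqp) (sym pqm).
split=> // t abt; split=> Lt.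
  case: (ipt_total abp abt) => [apt|atp]; first exact: (ipt_sub amp).
  have aqt : I a q t.
    by case: (ipt_total abt abq) => // atq; case: Lq; exact: (iL t q).
  apply: (ipt_sub_r amp); apply: (cm t _).1 => //; exact: ipt_swap aqt atp.
case: (ipt_total abq abt) => [aqt|atq]; last exact: (ipt_sub atq).
have atp : I a t p.
  by case: (ipt_total abp abt) => // apt; case: Lt; exact: (iL p t).
apply: (ipt_sub_r atp); apply: (cm t _).2 => //; exact: ipt_swap aqt atp.
Qed.

Lemma interval_complete_glue a b u : I a b u ->
  interval_complete a u -> interval_complete u b -> interval_complete a b.
Proof.
move=> abu cau cub L iL La Lb; case: (pselect (L u)) => Lu.
  case: (cub L _ Lu Lb) => [|m cm].
    by apply: initial_segment_sub iL => //; exact: ipt_right.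
  by exists m; apply: interval_cut_local cm => //; exact: ipt_right.
case: (cau L _ La Lu) => [|m cm].
  by apply: initial_segment_sub iL => //; exact: lft.
by exists m; apply: interval_cut_local cm => //; exact: lft.
Qed.

Lemma interval_complete_sym a b :
  interval_complete a b -> interval_complete b a.
Proof.
move=> cab L iL Lb La.
have [||/= |m [abm cm]] := cab (~` L); rewrite /setC /=.
- move=> t s abt Lt ats Ls; apply: Lt.
  have abs : I a b s by exact: (ipt_sub abt).
  by apply: (iL s t (sym abs) Ls); apply: sym; exact: ipt_swap abt ats.
- by [].
- by apply.
exists m; split=> [|t /sym abt]; first exact: sym.
have [c1 c2] := cm t abt; split => Lt.
  by apply: sym; apply: ipt_swap abt _; apply: c2; apply.
by apply: sym; apply: ipt_swap abm _; apply: c1.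
Qed.

End IntervalPretree.

Arguments interval_cut {T} I a b L m.
Arguments initial_segment {T} I a b L.
Arguments interval_complete {T} I a b.

(** * Order topologies *)

Section OrderTopology.
Context {d : Order.disp_t} {J : orderTopologicalType d}.
Implicit Types (x y l h : J) (O : set J).

Lemma nbhs_order_right x h O : nbhs x O -> (x < h)%O ->
  exists2 y, (x < y)%O & forall t, (x <= t < y)%O -> O t.
Proof.
rewrite itv_nbhsE => -[[a b]] [oe xi] sO xh; move: xi; rewrite itv_boundlr.
case/andP => ax xb.
have at_ t : (x <= t)%O -> (a <= BLeft t)%O.
  by move=> xt; apply: le_trans ax _; rewrite bnd_simp.
case: b oe xb sO => [[] b|[]] oe xb sO.
- exists b; first by move: xb; rewrite bnd_simp.
  move=> t /andP[xt tb]; apply: sO; rewrite /= itv_boundlr at_ //.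
- by clear ax at_; case: a oe sO => [[]?|[]].
- by [].
- exists h => // t /andP[xt _]; apply: sO; rewrite /= itv_boundlr at_ //.
Qed.

Lemma nbhs_order_left x l O : nbhs x O -> (l < x)%O ->
  exists2 y, (y < x)%O & forall t, (y < t <= x)%O -> O t.
Proof.
rewrite itv_nbhsE => -[[a b]] [oe xi] sO lx; move: xi; rewrite itv_boundlr.
case/andP => ax xb.
have tb t : (t <= x)%O -> (BRight t <= b)%O.
  by move=> tx; apply: le_trans xb; rewrite bnd_simp.
case: a oe ax sO => [[] a|[]] oe ax sO.
- by clear xb tb sO; case: b oe => [[]?|[]].
- exists a; first by move: ax; rewrite bnd_simp.
  move=> t /andP[lt_at tx]; apply: sO; rewrite /= itv_boundlr tb // andbT.
  by rewrite bnd_simp.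
- exists l => // t /andP[_ tx]; apply: sO; rewrite /= itv_boundlr tb // andbT ?bnd_simp.
- by [].
Qed.

Lemma continuous_order (S : topologicalType) (f : S -> J) :
  (forall c, open (f @^-1` [set t | (t < c)%O])) ->
  (forall c, open (f @^-1` [set t | (c < t)%O])) -> continuous f.
Proof.
move=> ol og x U /=; rewrite {1}itv_nbhsE => -[[a b]] /= [oe xi] sU.
have oI c : open_nbhs x (f @^-1` c) -> nbhs x (f @^-1` c).
  exact: open_nbhs_nbhs.
suff : nbhs x (f @^-1` [set` Interval a b]) by apply: filterS => y /= /sU.
have -> : f @^-1` [set` Interval a b] =
    f @^-1` [set` Interval a +oo%O] `&` f @^-1` [set` Interval -oo%O b].
  rewrite -preimage_setI; congr (_ @^-1` _).
  by rewrite set_itv_splitI.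
have xa : (a <= BLeft (f x))%O by move: xi; rewrite itv_boundlr => /andP[].
have xb : (BRight (f x) <= b)%O by move: xi; rewrite itv_boundlr => /andP[].
apply: filterI.
  case: a oe xa {xi sU} => [[] a|[]] oe xa.
  - by case: b oe {xb} => [[] ?|[]].
  - apply: open_nbhs_nbhs; split => /=; last first.
      by rewrite in_itv /= andbT; move: xa; rewrite bnd_simp.
    have := og a; congr (open (_ @^-1` _)); apply/seteqP; split=> y /=;
    by rewrite in_itv /= andbT.
  - by apply: (filterS _ filterT) => y _ /=; rewrite in_itv.
  - by [].
case: b oe xb {xi sU xa} => [[] b|[]] oe xb.
- apply: open_nbhs_nbhs; split => /=; last first.
    by rewrite in_itv /=; move: xb; rewrite bnd_simp.
  have := ol b; congr (open (_ @^-1` _)); apply/seteqP; split=> y /=;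
  by rewrite in_itv.
- by case: a oe => [[] ?|[]].
- by [].
- by apply: (filterS _ filterT) => y _ /=; rewrite in_itv.
Qed.

(** A cluster point of the filter of final rays is a greatest element. *)
Lemma compact_order_max : compact [set: J] -> [set: J] !=set0 ->
  exists h, forall x, (x <= h)%O.
Proof.
move=> cJ [x0 _]; pose F := filter_from [set: J] (fun y => [set t | (y <= t)%O]).
have FF : ProperFilter F.
  apply: filter_from_proper; last by move=> y _; exists y => /=.
  apply: filter_from_filter; first by exists x0.
  move=> y z _ _; exists (Order.max y z) => // t /=.
  by rewrite ge_max => /andP[].
have [|h [_ hF]] := cJ F FF; first by exists x0.
exists h => x; rewrite leNgt; apply/negP => hx.
have Fx : F [set t | (x <= t)%O] by exists x.
have [|t [/= xt]] := hF _ [set t | (t < x)%O] Fx.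
  apply: open_nbhs_nbhs; split => //.
  have := @lray_open _ J x; congr (open _); apply/seteqP; split=> y /=;
  by rewrite in_itv.
by rewrite ltNge xt.
Qed.

Lemma compact_order_min : compact [set: J] -> [set: J] !=set0 ->
  exists l, forall x, (l <= x)%O.
Proof.
move=> cJ [x0 _]; pose F := filter_from [set: J] (fun y => [set t | (t <= y)%O]).
have FF : ProperFilter F.
  apply: filter_from_proper; last by move=> y _; exists y => /=.
  apply: filter_from_filter; first by exists x0.
  move=> y z _ _; exists (Order.min y z) => // t /=.
  by rewrite le_min => /andP[].
have [|l [_ lF]] := cJ F FF; first by exists x0.
exists l => x; rewrite leNgt; apply/negP => xl.
have Fx : F [set t | (t <= x)%O] by exists x.
have [|t [/= tx]] := lF _ [set t | (x < t)%O] Fx.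
  apply: open_nbhs_nbhs; split => //.
  have := @rray_open _ J x; congr (open _); apply/seteqP; split=> y /=;
  by rewrite in_itv /= andbT.
by rewrite ltNge tx.
Qed.

Section Continuum.
Variables l h : J.
Hypothesis lh : forall x, (l <= x <= h)%O.
Hypothesis dense_order : forall x y, (x < y)%O -> exists z, (x < z < y)%O.
Hypothesis order_cut : forall L : set J, (forall x y, (x <= y)%O -> L y -> L x) ->
  L l -> ~ L h -> exists m, (forall t, (t < m)%O -> L t) /\
    (forall t, (m < t)%O -> ~ L t).

Let ltP x y : ~ (x <= y)%O -> (y < x)%O.
Proof. by move=> /negP; rewrite -ltNge. Qed.

(** An ultrafilter converges to the point that fills the cut made of the [x]
    whose final ray is large for it. *)
Lemma complete_order_compact : compact [set: J].
Proof.
rewrite compact_ultra => F UF _.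
pose L := [set x | F [set t | (x <= t)%O]].
have L_l : L l by apply: (filterS _ filterT) => t _ /=; have /andP[] := lh t.
case: (pselect (L h)) => Lh.
  exists h; split=> // O /nbhs_singleton Oh.
  apply: filterS Lh => t /= ht; suff -> : t = h by [].
  by apply/eqP; rewrite eq_le ht; have /andP[_ ->] := lh t.
have [|m [mL mN]] := order_cut _ L_l Lh.
  by move=> x y xy; apply: filterS => t /=; exact: le_trans.
exists m; split=> // O Om.
have Fr y : (m < y)%O -> F [set t | (t < y)%O].
  move=> /mN nL; case: (in_ultra_setVsetC [set t | (y <= t)%O] UF) => // FC.
  by apply: filterS FC => t /= /ltP.
have FR : F [set t | (m <= t)%O -> O t].
  case: (eqVneq m h) => [mh|nmh].
    apply: (filterS _ filterT) => t _ /= mt.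
    suff -> : t = m by exact: nbhs_singleton.
    by apply/eqP; rewrite eq_le mt mh; have /andP[_ ->] := lh t.
  have mh : (m < h)%O by rewrite lt_neqAle nmh; have /andP[] := lh m.
  have [y my yO] := nbhs_order_right Om mh.
  by apply: filterS (Fr y my) => t /= ty mt; apply: yO; rewrite mt.
have FL : F [set t | (t < m)%O -> O t].
  case: (eqVneq l m) => [lm|nlm].
    apply: (filterS _ filterT) => t _ /=; rewrite ltNge -lm.
    by have /andP[->] := lh t.
  have lm : (l < m)%O by rewrite lt_neqAle nlm; have /andP[] := lh m.
  have [y ym yO] := nbhs_order_left Om lm.
  have [z /andP[yz zm]] := dense_order ym.
  have Fz : F [set t | (z <= t)%O] by exact: mL.
  apply: filterS Fz => t /= zt tm.
  by apply: yO; rewrite (lt_le_trans yz zt) ltW.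
apply: filterS (filterI FR FL) => t /= [].
by case: (leP m t) => [mt H _|tm _ H]; exact: H.
Qed.

(** The end of the longest initial ray contained in a clopen set can lie neither
    in the set nor outside, unless the set is everything. *)
Lemma complete_order_connected : connected [set: J].
Proof.
have key (B : set J) : open B -> open (~` B) -> B l -> B = setT.
  move=> oB oC Bl; pose L := [set x | forall t, (t <= x)%O -> B t].
  suff Lh : L h.
    by apply/seteqP; split=> // t _; apply: Lh; have /andP[] := lh t.
  apply: contrapT => Lh; have [||m [mL mN]] := order_cut _ _ Lh.
  - by move=> x y xy Ly t tx; apply: Ly; exact: le_trans xy.
  - move=> t tl; suff -> : t = l by [].
    by apply/eqP; rewrite eq_le tl; have /andP[->] := lh t.
  case: (pselect (B m)) => Bm.
    have Lm : L m.
      move=> t; rewrite le_eqVlt => /orP[/eqP -> //|tm].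
      exact: (mL t tm).
    have mh : (m < h)%O.
      rewrite lt_neqAle; have /andP[_ ->] := lh m; rewrite andbT.
      by apply/eqP => mh; apply: Lh; rewrite -mh.
    have nB : nbhs m B by exact: open_nbhs_nbhs.
    have [y my yB] := nbhs_order_right nB mh.
    have [z /andP[mz zy]] := dense_order my.
    apply: (mN z mz) => t tz; case: (leP t m) => [|mt]; first exact: Lm.
    by apply: yB; rewrite (ltW mt) (le_lt_trans tz).
  have lm : (l < m)%O.
    rewrite lt_neqAle; have /andP[-> _] := lh m; rewrite andbT.
    by apply/eqP => lm; apply: Bm; rewrite -lm.
  have nB : nbhs m (~` B) by exact: open_nbhs_nbhs.
  have [y ym yB] := nbhs_order_left nB lm.
  have [z /andP[yz zm]] := dense_order ym.
  have : (~` B) z by apply: yB; rewrite yz ltW.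
  by apply; apply: (mL z zm).
move=> B [x Bx] [C oC]; rewrite setTI => BC [D cD]; rewrite setTI => BD.
have oB : open B by rewrite BC.
have oN : open (~` B) by rewrite BD; exact: closed_openC.
case: (pselect (B l)) => Bl; first exact: key.
have := key _ oN; rewrite setCK => /(_ oB Bl) h0.
by have : (~` B) x by rewrite h0.
Qed.

Lemma order_separable (D : set J) : (l < h)%O -> countable D ->
  (forall s t, (s < t)%O -> exists2 u, D u & (s <= u <= t)%O) -> separable J.
Proof.
move=> llh cD Dd; exists D => // O [x Ox] oO.
have nO : nbhs x O by exact: open_nbhs_nbhs.
case: (eqVneq x h) => [xh|nxh].
  rewrite -xh in llh; have [y yx yO] := nbhs_order_left nO llh.
  have [z /andP[yz zx]] := dense_order yx.
  have [u Du /andP[zu ux]] := Dd _ _ zx.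
  by exists u; split=> //; apply: yO; rewrite ux (lt_le_trans yz).
have xh : (x < h)%O by rewrite lt_neqAle nxh; have /andP[] := lh x.
have [y xy yO] := nbhs_order_right nO xh.
have [z /andP[xz zy]] := dense_order xy.
have [u Du /andP[xu uz]] := Dd _ _ xz.
by exists u; split=> //; apply: yO; rewrite xu (le_lt_trans uz).
Qed.

End Continuum.
End OrderTopology.

(** * Big arcs in a pretree with its branch topology *)

(** [[set t | ~ I s t a]] is the branch at [a] that contains [s], for
    [s <> a]. The second is the universal property of the coarsest topology with
    open branches. *)
Definition branch_topology (T : topologicalType) (I : T -> T -> set T) :=
  (forall s a, open [set t | ~ I s t a]) /\
  forall (S : topologicalType) (f : S -> T),
    (forall s a, open (f @^-1` [set t | ~ I s t a])) -> continuous f.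

(** In a dense order a countable set that meets all nondegenerate closed
    intervals is topologically dense. *)
Definition interval_separable (T : Type) (I : T -> T -> set T) :=
  forall p q, exists2 D : set T, countable D &
    forall s t, I p q s -> I p q t -> s <> t -> I s t `&` D !=set0.

Section Arc.
Context {T : topologicalType} {I : T -> T -> set T} (IP : interval_pretree I).

(** The proof that [I] is a pretree is an argument of the type so that the order
    of the interval can be attached to the type as an instance. *)
Definition arc (_ : interval_pretree I) (p q : T) : Type := set_type (I p q).

Section ArcOrder.
Variables p q : T.
Local Notation A := (arc IP p q).

HB.instance Definition _ := Choice.copy A (set_type (I p q)).

Definition arc_val (x : A) : T := \val (x : set_type (I p q)).

Lemma arc_valP (x : A) : I p q (arc_val x).
Proof. exact: set_valP. Qed.

Lemma arc_val_inj : injective arc_val.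
Proof. exact: val_inj. Qed.

Definition arc_le (x y : A) : bool := `[< I p (arc_val y) (arc_val x) >].

Lemma arc_le_refl : reflexive arc_le.
Proof. by move=> x; apply/asboolP; exact: (ipt_right IP). Qed.

Lemma arc_le_anti : antisymmetric arc_le.
Proof.
move=> x y /andP[/asboolP xy /asboolP yx]; apply: arc_val_inj.
exact: (ipt_anti IP xy yx).
Qed.

Lemma arc_le_trans : transitive arc_le.
Proof.
move=> y x z /asboolP xy /asboolP yz; apply/asboolP.
exact: (ipt_sub IP yz).
Qed.

HB.instance Definition _ :=
  @Order.Le_isPOrder.Build (Order.Disp tt tt) A arc_le
    arc_le_refl arc_le_anti arc_le_trans.

Lemma arc_le_total : total arc_le.
Proof.
move=> x y; have [h|h] := ipt_total IP (arc_valP x) (arc_valP y).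
  by apply/orP; right; apply/asboolP.
by apply/orP; left; apply/asboolP.
Qed.

HB.instance Definition _ := Order.POrder_isTotal.Build _ A arc_le_total.

End ArcOrder.

Definition oarc p q := order_topology (arc IP p q).
HB.instance Definition _ p q := OrderTopological.on (oarc p q).

Section ArcIsBigArc.
Variables p q : T.
Local Notation J := (oarc p q).
Implicit Types x y : J.

Definition arc_mk t (h : I p q t) : J := SigSub (mem_set h).

Lemma arc_leP x y : reflect (I p (arc_val y) (arc_val x)) (x <= y)%O.
Proof. exact: asboolP. Qed.

Lemma arc_leP_r x y : reflect (I q (arc_val x) (arc_val y)) (x <= y)%O.
Proof.
apply: (iffP (arc_leP x y)) => h.
  apply: (ipt_sym IP).
  exact: (ipt_swap IP (arc_valP y) h).
apply: (ipt_sym IP).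
exact: (ipt_swap IP (ipt_sym IP (arc_valP x)) h).
Qed.

Lemma arc_ltP x y : reflect (~ I q (arc_val y) (arc_val x)) (x < y)%O.
Proof. by rewrite ltNge; apply: (iffP negP) => h /arc_leP_r. Qed.

Lemma arc_ltP_l x y : reflect (~ I p (arc_val x) (arc_val y)) (x < y)%O.
Proof. by rewrite ltNge; apply: (iffP negP) => h /arc_leP. Qed.

Lemma arc_between x y t : (x <= y)%O -> I (arc_val x) (arc_val y) t ->
  exists2 z : J, arc_val z = t & (x <= z <= y)%O.
Proof.
move=> /arc_leP xy xyt.
have pyt : I p (arc_val y) t by exact: (ipt_sub_r IP xy).
have pqt : I p q t by exact: (ipt_sub IP (arc_valP y)).
exists (arc_mk pqt) => //; apply/andP; split; apply/arc_leP => //=.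
apply: (ipt_sym IP); exact: (ipt_swap IP (ipt_sym IP xy) (ipt_sym IP xyt)).
Qed.

Lemma arc_ends x : (arc_mk (ipt_left IP p q) <= x <= arc_mk (ipt_right IP p q))%O.
Proof.
apply/andP; split; apply/arc_leP; first exact: (ipt_left IP).
exact: arc_valP.
Qed.

Lemma arc_dense x y : interval_dense I -> (x < y)%O ->
  exists z : J, (x < z < y)%O.
Proof.
move=> dI xy; have [t [xyt tx ty]] : exists t, [/\ I (arc_val x) (arc_val y) t,
    t <> arc_val x & t <> arc_val y].
  apply: dI => /arc_val_inj e; by rewrite e ltxx in xy.
have [z zt /andP[xz zy]] := arc_between (ltW xy) xyt.
exists z; rewrite !lt_neqAle xz zy !andbT; apply/andP; split; apply/eqP => e.
  by apply: tx; rewrite -zt e.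
by apply: ty; rewrite -zt e.
Qed.

Lemma arc_order_cut (L : set J) : interval_complete I p q ->
  (forall x y, (x <= y)%O -> L y -> L x) ->
  L (arc_mk (ipt_left IP p q)) -> ~ L (arc_mk (ipt_right IP p q)) ->
  exists m, (forall t, (t < m)%O -> L t) /\ (forall t, (m < t)%O -> ~ L t).
Proof.
move=> cI dL Ll Lh; pose L' := [set t | exists2 x, arc_val x = t & L x].
have [||[x xq Lx]|m [pqm cm]] := cI L'.
- move=> t s pqt [x <- Lx] ps.
  have pqs : I p q s by exact: (ipt_sub IP (arc_valP x)).
  exists (arc_mk pqs) => //; apply: dL Lx; exact/arc_leP.
- by exists (arc_mk (ipt_left IP p q)).
- apply: Lh; apply: dL Lx; apply/arc_leP; rewrite xq; exact: (ipt_right IP).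
have valL x : L' (arc_val x) -> L x by move=> [y /arc_val_inj -> ].
exists (arc_mk pqm); split => t tm.
  apply: contrapT => Lt; have [_ h] := cm _ (arc_valP t).
  move: tm; rewrite ltNge => /negP; apply; apply/arc_leP; apply: h.
  by move/valL.
move=> Lt; have [h _] := cm _ (arc_valP t).
move: tm; rewrite ltNge => /negP; apply; apply/arc_leP; apply: h.
by exists t.
Qed.

Lemma arc_compact : interval_dense I -> interval_complete I p q ->
  compact [set: J].
Proof.
move=> dI cI; apply: (complete_order_compact arc_ends).
  by move=> x y; exact: arc_dense.
by move=> L; exact: arc_order_cut.
Qed.

Lemma arc_connected : interval_dense I -> interval_complete I p q ->
  connected [set: J].
Proof.
move=> dI cI; apply: (complete_order_connected arc_ends).
  by move=> x y; exact: arc_dense.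
by move=> L; exact: arc_order_cut.
Qed.

Hypothesis BT : branch_topology I.

(** A branch at [a] traces on the interval a set that is everything if [a] is
    not in the interval, and otherwise a ray ending at [a]. *)
Lemma arc_val_continuous : continuous (fun x : J => arc_val x).
Proof.
case: BT => _; apply=> s a; rewrite openE /interior => x /= sxa.
have sub : [set y : J | ~ I (arc_val x) (arc_val y) a] `<=`
    (fun y : J => arc_val y) @^-1` [set t | ~ I s t a].
  by move=> y /= xya /(ipt_cover IP (arc_val x)) [].
apply: (filterS sub); case: (pselect (I p q a)) => pqa; last first.
  apply: (filterS _ filterT) => y _ /= xya; apply: pqa.
  exact: (ipt_convex IP (arc_valP x) (arc_valP y)).
have : arc_mk pqa != x.
  apply/eqP => ax; apply: sxa; rewrite -ax; exact: (ipt_right IP).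
move/lt_total; case/orP => ax.
- apply: (@filterS _ _ _ `]arc_mk pqa, +oo[%classic); last first.
    by apply: open_nbhs_nbhs; split; [exact: rray_open | rewrite /= in_itv /= ax].
  move=> y; rewrite /= in_itv /= andbT => ay xya.
  wlog xy : x y {sxa sub} ax ay xya / (x <= y)%O.
    move=> H; case/orP: (le_total x y) => h; first exact: (H x y).
    apply: (H y x) => //; exact: (ipt_sym IP).
  have [z za /andP[xz zy]] := arc_between xy xya.
  have zE : z = arc_mk pqa by exact: arc_val_inj.
  by move: ax; rewrite ltNge -zE xz.
- apply: (@filterS _ _ _ `]-oo, arc_mk pqa[%classic); last first.
    by apply: open_nbhs_nbhs; split; [exact: lray_open | rewrite /= in_itv /= ax].
  move=> y; rewrite /= in_itv /= => ay xya.
  wlog xy : x y {sxa sub} ax ay xya / (x <= y)%O.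
    move=> H; case/orP: (le_total x y) => h; first exact: (H x y).
    apply: (H y x) => //; exact: (ipt_sym IP).
  have [z za /andP[xz zy]] := arc_between xy xya.
  have zE : z = arc_mk pqa by exact: arc_val_inj.
  by move: ay; rewrite ltNge -zE zy.
Qed.

(** Conversely each ray of the interval is the trace of a branch. *)
Lemma arc_homeomorphism : homeomorphism (fun x : J => x : set_type (I p q)).
Proof.
split.
  apply/continuousP => B [C oC <-].
  by have /continuousP /(_ C oC) := arc_val_continuous.
exists (fun x : set_type (I p q) => x : J); split => //.
case: BT => oI _; apply: continuous_order => c.
  have -> : (fun x : set_type (I p q) => x : J) @^-1` [set t | (t < c)%O] =
      set_val @^-1` [set t | ~ I p t (arc_val c)].
    by apply/seteqP; split=> x /= /arc_ltP_l.
  by exists [set t | ~ I p t (arc_val c)].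
have -> : (fun x : set_type (I p q) => x : J) @^-1` [set t | (c < t)%O] =
    set_val @^-1` [set t | ~ I q t (arc_val c)].
  by apply/seteqP; split=> x /= /arc_ltP.
by exists [set t | ~ I q t (arc_val c)].
Qed.

End ArcIsBigArc.

Section RealTree.
Hypotheses (BT : branch_topology I) (dI : interval_dense I).
Hypothesis cI : forall p q, interval_complete I p q.

Lemma interval_big_arc p q : p <> q -> big_arc_between (I p q) p q.
Proof.
move=> pq; exists _, (oarc p q), (fun x => x); split.
- exact: arc_compact.
- exact: arc_connected.
- exists (arc_mk (ipt_left IP p q)), (arc_mk (ipt_right IP p q)).
  by move=> /(congr1 (@arc_val p q)).
- exact: arc_homeomorphism.
- exists (arc_mk (ipt_left IP p q)), (arc_mk (ipt_right IP p q)).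
  by split=> // x; exact: arc_ends.
Qed.

(** A point [t] strictly between [p] and [q] separates them, by the branches at
    [t], so that a connected set containing both contains [t]; and a point of
    the arc outside [I p q] would separate [I p q], since it separates the
    ordered space parametrizing the arc. *)
Lemma big_arc_unique A p q : big_arc_between A p q -> A = I p q.
Proof.
move=> [d [J [f [cJ nJ _ [fc [g [fK gK gc]]] [l [h [lh fl fh]]]]]]].
have vc : continuous (fun x : J => \val (f x)).
  apply/continuousP => B oB.
  have /continuousP /(_ (set_val @^-1` B)) := fc; apply; by exists B.
have clopenJ (B : set J) : open B -> open (~` B) -> B l -> B h.
  move=> oB oN Bl; suff -> : B = setT by [].
  apply: nJ; first by exists l.
  - by exists B => //; rewrite setTI.
  - by exists B; rewrite ?setTI // -(setCK B); exact: open_closedC.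
have sub : I p q `<=` A.
  move=> t pqt; apply: contrapT => At; have [oI _] := BT.
  have fnt x : \val (f x) <> t by move=> e; apply: At; rewrite -e; exact: set_valP.
  pose B := (fun x : J => \val (f x)) @^-1` [set u | ~ I p u t].
  have oB : open B by have /continuousP := vc; apply; exact: oI.
  (* the other branches at t cover the rest of the arc *)
  have oN : open (~` B).
    have -> : ~` B = \bigcup_(s in [set s | I p s t])
        (fun x : J => \val (f x)) @^-1` [set u | ~ I s u t].
      apply/seteqP; split=> x.
        move=> /= /contrapT Bx; exists (\val (f x)) => //= /(ipt_refl IP).
        by move=> e; exact: (@fnt x).
      move=> [s /= pst sx] Bx.
      case: (ipt_cover IP (\val (f x)) pst) => pt; first exact: Bx.
      apply: sx; exact: (ipt_sym IP).
    apply: bigcup_open => s _; have /continuousP := vc; apply; exact: oI.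
  have [] := clopenJ B oB oN.
    by rewrite /B /= fl => /(ipt_refl IP) e; apply: (@fnt l); rewrite fl e.
  by rewrite fh.
apply/seteqP; split=> // t At; apply: contrapT => npqt.
pose j := g (SigSub (mem_set At)).
have fj : \val (f j) = t by rewrite /j gK.
pose incl (x : oarc p q) : set_type A := SigSub (mem_set (sub _ (arc_valP x))).
have incl_c : continuous incl.
  apply/continuousP => B [C oC <-].
  by have /continuousP /(_ C oC) := arc_val_continuous BT (p := p) (q := q).
pose k x := g (incl x).
have kc : continuous k by move=> x; apply: continuous_comp; [exact: incl_c|exact: gc].
have kj x : k x <> j.
  move=> e; apply: npqt; rewrite -fj -e /k gK; exact: arc_valP.
have ray c : open [set u : J | (u < c)%O].
  have := @lray_open _ J c; congr open; apply/seteqP; split=> y /=;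
  by rewrite in_itv.
have ray' c : open [set u : J | (c < u)%O].
  have := @rray_open _ J c; congr open; apply/seteqP; split=> y /=;
  by rewrite in_itv /= andbT.
pose B := k @^-1` [set u | (u < j)%O].
have oB : open B by have /continuousP := kc; apply; exact: ray.
have oN : open (~` B).
  have -> : ~` B = k @^-1` [set u | (j < u)%O].
    apply/seteqP; split=> x /=; last first.
      by move=> jx; rewrite /B /= => /(lt_trans jx); rewrite ltxx.
    move=> /negP; rewrite -leNgt le_eqVlt => /orP[/eqP e|//].
    by case: (kj x).
  by have /continuousP := kc; apply; exact: ray'.
pose x0 := arc_mk (ipt_left IP p q); pose x1 := arc_mk (ipt_right IP p q).
have kx0 : k x0 = l.
  rewrite -[RHS]fK /k; congr g; apply: val_inj; rewrite fl.
  by [].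
have kx1 : k x1 = h.
  rewrite -[RHS]fK /k; congr g; apply: val_inj; rewrite fh.
  by [].
have Bx0 : B x0.
  rewrite /B /= kx0 lt_neqAle; have /andP[-> _] := lh j; rewrite andbT.
  by apply/eqP => e; apply: (kj x0); rewrite kx0.
have BT' : B = setT.
  apply: (arc_connected (p := p) (q := q) dI (@cI p q)); first by exists x0.
  - by exists B => //; rewrite setTI.
  - by exists B; rewrite ?setTI // -(setCK B); exact: open_closedC.
have : B x1 by rewrite BT'.
by rewrite /B /= kx1 ltNge; have /andP[_ ->] := lh j.
Qed.

(** The ends of a big arc are its least and greatest element, which exist by
    compactness; so every big arc is one of the intervals of the pretree. *)
Lemma interval_real_tree : interval_separable I -> real_tree T.
Proof.
move=> sI; split=> [p q pq|A arcA].
  exists (I p q); split; first exact: interval_big_arc.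
  by move=> A /big_arc_unique.
split=> //; have [d [J [f [cJ nJ [x [y xy]] hf]]]] := arcA.
have J0 : [set: J] !=set0 by exists x.
have [l hl] := compact_order_min cJ J0.
have [h hh] := compact_order_max cJ J0.
pose p := \val (f l); pose q := \val (f h).
have AE : A = I p q.
  apply: big_arc_unique; exists d, J, f; split=> //; first by exists x, y.
  by exists l, h; split=> // z; rewrite hl hh.
have pq : p <> q.
  move=> /val_inj e; have [_ [g [fK _ _]]] := hf.
  have lh : l = h by rewrite -(fK l) e fK.
  have xl z : z = l by apply/eqP; rewrite eq_le hl {1}lh hh.
  by apply: xy; rewrite (xl x) (xl y).
rewrite {}AE; have [D cD hD] := sI p q.
pose D' := [set z : oarc p q | D (arc_val z)].
have [] := @order_separable _ (oarc p q) _ _ (@arc_ends p q) _ D'.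
- by move=> u v; exact: arc_dense.
- rewrite lt_neqAle; have /andP[-> _] := arc_ends (arc_mk (ipt_right IP p q)).
  by rewrite andbT; apply/eqP => /(congr1 (@arc_val p q)).
- apply/countable_injP; have /countable_injP[phi phiI] := cD.
  exists (fun z => phi (arc_val z)) => u v /set_mem Du /set_mem Dv /phiI e.
  by apply: arc_val_inj; apply: e; apply/mem_set.
- move=> s t st; have [u [stu Du]] : I (arc_val s) (arc_val t) `&` D !=set0.
    apply: hD; try exact: arc_valP.
    by move=> /arc_val_inj e; rewrite e ltxx in st.
  have [z zu szt] := arc_between (ltW st) stu.
  by exists z => //; rewrite /D' /= zu.
move=> Q cQ dQ; exists Q => // O O0 oO.
have [_ [g [_ _ gc]]] := arc_homeomorphism p q BT.
have [fc _] := arc_homeomorphism p q BT.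
by apply: dQ => //; have /continuousP := fc; exact.
Qed.

End RealTree.
End Arc.

(** * Points that separate a connected space *)

Section Separation.
Context {X : topologicalType}.
Implicit Types (a b c d e : X) (U V W : set X).

Definition sep a c b := separates [set c] [set a] [set b].

(** [V] is a clopen part of the complement of [e]. *)
Definition half e V := [/\ open V, ~ V e & open (~` (V `|` [set e]))].

Definition other_half e V := ~` (V `|` [set e]).

Hypothesis hX : hausdorff_space X.

Let closed1 e : closed [set e].
Proof. exact/accessible_closed_set1/hausdorff_accessible. Qed.

Lemma sepP a c b :
  sep a c b <-> exists V, [/\ half c V, V a, ~ V b & b <> c].
Proof.
have oC : open (~` [set c]) by exact: closed_openC.
split.
  move=> [_ _ [U [V [[W oW WU] [W' oW' WV] UV0 [aU bV] UVC]]]].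
  have oU : open U by rewrite WU; exact: openI.
  have oV : open V by rewrite WV; exact: openI.
  have Ua : U a by exact: aU.
  have Vb : V b by exact: bV.
  exists U; split => //.
  - split=> //; first by move=> Uc; have : (~` [set c]) c by [rewrite -UVC; left]; exact.
    suff -> : ~` (U `|` [set c]) = V by [].
    apply/seteqP; split=> z.
      move=> /not_orP[nU nc]; have : (~` [set c]) z by [].
      by rewrite -UVC => -[].
    move=> Vz [Uz|zc]; first by have : (U `&` V) z by []; rewrite UV0.
    by have : (~` [set c]) z by [rewrite -UVC; right]; exact.
  - by move=> Ub; have : (U `&` V) b by []; rewrite UV0.
  - by move=> bc; have : (~` [set c]) b by [rewrite -UVC; right]; exact.
move=> [V [[oV Vc oC'] Va Vb bc]]; split; [by exists a|by exists b|].
have VC : V `<=` ~` [set c] by move=> z Vz zc; apply: Vc; rewrite -zc.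
exists V, (other_half c V); split.
- by exists V => //; apply/seteqP; split=> z; [split=> //; exact: VC|case].
- exists (other_half c V) => //; apply/seteqP; split=> z; last by case.
  by move=> h; split=> // zc; apply: h; right.
- by apply/seteqP; split=> z //= -[Vz]; apply; left.
- by split=> z -> //=; move=> [].
- apply/seteqP; split=> z; first by move=> [/VC //|h zc]; apply: h; right.
  by move=> zc; case: (pselect (V z)) => Vz; [left|right => -[]].
Qed.

Lemma half_other e V : half e V -> half e (other_half e V).
Proof.
move=> [oV Ve oC]; split=> //; first by move=> h; apply: h; right.
suff -> : ~` (other_half e V `|` [set e]) = V by [].
apply/seteqP; split=> z.
  by move=> /not_orP[/contrapT[|]].
by move=> Vz [h|ze]; [apply: h; left | apply: Ve; rewrite -ze].
Qed.

Lemma halfU e V W : half e V -> half e W -> half e (V `|` W).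
Proof.
move=> [oV Ve oCV] [oW We oCW]; split; first exact: openU.
  by move=> [].
suff -> : ~` (V `|` W `|` [set e]) = ~` (V `|` [set e]) `&` ~` (W `|` [set e]).
  exact: openI.
by rewrite -setCU; congr (~` _); rewrite setUUl.
Qed.

Lemma half_closed e V : half e V -> closed (V `|` [set e]).
Proof. by move=> [_ _ oC]; rewrite -(setCK (V `|` _)); exact: open_closedC. Qed.

Lemma sep_sym a c b : sep a c b -> sep b c a.
Proof.
move=> /sepP [V [hV Va Vb bc]]; apply/sepP; exists (other_half c V); split.
- exact: half_other.
- by move=> [].
- by apply; left.
- by move=> ac; case: hV => _ Vc _; apply: Vc; rewrite -ac.
Qed.

Lemma sep_neq_l a c b : sep a c b -> a <> c.
Proof. by move=> /sepP [V [[_ Vc _] Va _ _]] ac; apply: Vc; rewrite -ac. Qed.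

Lemma sep_neq_r a c b : sep a c b -> b <> c.
Proof. by move=> /sepP [V []]. Qed.

Lemma sep_irrefl a c : ~ sep a c a.
Proof. by move=> /sepP [V []]. Qed.

Lemma sep_cover a c b d : sep a c b -> d <> c -> sep a c d \/ sep d c b.
Proof.
move=> /sepP [V [hV Va Vb bc]] dc; case: (pselect (V d)) => Vd.
  by right; apply/sepP; exists V.
by left; apply/sepP; exists V.
Qed.

Lemma sep_cut_point a c b : sep a c b -> cut_point c.
Proof. by exists a, b. Qed.

Lemma cut_point_sep c a : cut_point c -> a <> c -> exists b, sep a c b.
Proof.
move=> [u [v uv]] ac; have [ua|av] := sep_cover uv ac; last by exists v.
by exists u; exact: sep_sym.
Qed.

Hypothesis connX : connected [set: X].

Lemma clopen_trivial (B : set X) x : open B -> open (~` B) -> B x -> B = setT.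
Proof.
move=> oB oN Bx; apply: connX; first by exists x.
- by exists B => //; rewrite setTI.
- by exists B; rewrite ?setTI // -(setCK B); exact: open_closedC.
Qed.

(** The fact on which everything rests: [V `&` V'] is open, and it is closed as
    the intersection of the closures [V `|` [set e]] and [V' `|` [set e']]. *)
Lemma half_disjoint e e' V V' : half e V -> half e' V' -> e <> e' ->
  ~ V e' -> ~ V' e -> V `&` V' = set0.
Proof.
move=> hV hV' ee' Ve' V'e; apply/seteqP; split=> // x Vx.
have : (V `&` V') e.
  rewrite (@clopen_trivial (V `&` V') x) //.
    by case: hV hV' => oV _ _ [oV' _ _]; exact: openI.
  apply: closed_openC.
  have -> : V `&` V' = (V `|` [set e]) `&` (V' `|` [set e']).
    apply/seteqP; split=> z; first by move=> [Vz V'z]; split; left.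
    move=> [[Vz|/= ze] [V'z|/= ze']] //.
    - by case: Ve'; rewrite -ze'.
    - by case: V'e; rewrite -ze.
    - by case: ee'; rewrite -ze.
  by apply: closedI; exact: half_closed.
by case: hV => _ nVe _ [/nVe].
Qed.

Lemma sep_anti a b c : sep a c b -> ~ sep a b c.
Proof.
move=> /sepP [V [hV Va Vb bc]] /sepP [W [hW Wa Wc cb]].
have : (V `&` W) a by [].
by rewrite (half_disjoint hV hW).
Qed.

End Separation.

(** * The core of a coherent choice of directions *)

Section FiniteSubcover.
Context {X : topologicalType}.

(** [x0] is the base point of the pointed space to which [compact_cover] is
    applied. *)
Lemma compact_finite_cover (x0 : X) (C : set X) (J : choiceType) (D : set J)
    (f : J -> set X) : compact C -> (forall i, D i -> open (f i)) ->
  C `<=` \bigcup_(i in D) f i ->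
  exists2 s : seq J, (forall i, i \in s -> D i) &
    C `<=` [set z | exists2 i, i \in s & f i z].
Proof.
pose Xp : ptopologicalType := HB.pack (X : Type) X (isPointed.Build (X : Type) x0).
move=> cC oD cov.
have : @compact Xp C by [].
rewrite compact_cover => /(_ J D f oD cov) [s sD sC].
exists (enum_fset s); first by move=> i /sD /set_mem.
by move=> z /sC [i /= si fz]; exists i.
Qed.

End FiniteSubcover.

Section Orientation.
Context {X : topologicalType}.
Implicit Types (a b c d e p : X) (U V W O : set X).
Hypothesis hX : hausdorff_space X.
Hypothesis compX : compact [set: X].
Hypothesis connX : connected [set: X].

Variable w : X -> X.
Hypothesis w_neq : forall e, w e <> e.
Hypothesis w_coherent : forall e e', e <> e' ->
  sep (w e) e e' -> ~ sep (w e') e' e.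

(** [w e] marks a preferred direction at each point [e], and an [away] set is a
    clopen part of the complement of [e] that avoids this direction. The
    coherence hypothesis says that no two points see each other away from their
    preferred directions, so that two [away] sets never cover the space. *)
Definition away e V := half e V /\ ~ V (w e).

(** What remains of the space after removing all [away] sets, by [coreP]. *)
Definition core := [set p | forall e, ~ sep (w e) e p].

Lemma awayP e p : sep (w e) e p <-> exists2 V, away e V & V p.
Proof.
split=> [/(sep_sym hX) /(sepP hX) [V [hV Vp Vw _]]|[V [hV Vw] Vp]].
  by exists V.
apply: (sep_sym hX); apply/(sepP hX); exists V; split=> //; exact: w_neq.
Qed.

Lemma coreP p : core p <-> forall e V, away e V -> ~ V p.
Proof.
split=> [cp e V aV Vp|h e /awayP [V aV]]; last exact: h aV.
by apply: (cp e); apply/awayP; exists V.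
Qed.

(** Coherence gives [~ V e'], so that [V] is disjoint from the other half at
    [e']. *)
Lemma away_nested e e' V V' : e <> e' -> away e V -> away e' V' -> V' e ->
  V `<=` V'.
Proof.
move=> ee' aV aV' V'e.
have nVe' : ~ V e'.
  move=> Ve'; apply: (w_coherent ee'); first by apply/awayP; exists V.
  by apply/awayP; exists V'.
have V0 : V `&` other_half e' V' = set0.
  apply: (half_disjoint connX aV.1 (half_other aV'.1) ee' nVe').
  by apply; left.
move=> z Vz; apply: contrapT => nV'z.
have : (V `&` other_half e' V') z.
  by split=> // -[//|ze']; apply: nVe'; rewrite -ze'.
by rewrite V0 => -[].
Qed.

Lemma away_overlap e e' V V' : away e V -> away e' V' -> V `&` V' !=set0 ->
  exists2 U, (exists e, away e U) & V `|` V' `<=` U.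
Proof.
move=> aV aV' [y [Vy V'y]]; case: (pselect (e = e')) => [ee'|ee'].
  subst e'; exists (V `|` V') => //; exists e; split; first exact: halfU aV.1 aV'.1.
  by move=> [/aV.2|/aV'.2].
case: (pselect (V' e)) => V'e.
  exists V'; first by exists e'.
  by move=> z [|//]; exact: (away_nested ee' aV aV' V'e).
case: (pselect (V e')) => Ve'.
  exists V; first by exists e.
  by move=> z [//|]; exact: (away_nested (nesym ee') aV' aV Ve').
have : (V `&` V') y by [].
by rewrite (half_disjoint connX aV.1 aV'.1 ee' Ve' V'e) => -[].
Qed.

Definition away_pair (y : X * set X) := away y.1 y.2.

Definition cut_off (s : seq (X * set X)) := [set z | exists2 y, y \in s & y.2 z].

(** By [away_nested], an [away] set whose centre lies in another one is
    superfluous; without them, sets with distinct centres are disjoint. *)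
Lemma reduce_away (s : seq (X * set X)) : (forall y, y \in s -> away_pair y) ->
  exists s' : seq (X * set X), [/\ forall y, y \in s' -> away_pair y,
    cut_off s `<=` cut_off s' &
    forall y z, y \in s' -> z \in s' -> ~ z.2 y.1].
Proof.
elim: s => [|y s IH] sA; first by exists [::]; split=> // z [].
have [|s' [sA' sub red]] := IH.
  by move=> z zs; apply: sA; rewrite inE zs orbT.
have yA : away_pair y by apply: sA; rewrite inE eqxx.
case: (pselect (exists2 z, z \in s' & z.2 y.1)) => [[z zs zy]|ny].
  exists s'; split=> // x [v]; rewrite inE => /orP[/eqP -> yx|vs vx]; last first.
    by apply: sub; exists v.
  exists z => //; apply: (away_nested _ yA (sA' _ zs) zy yx) => yz.
  by apply: (red z z zs zs); rewrite -yz.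
exists (y :: [seq z <- s' | ~~ `[< y.2 z.1 >]]); split.
- move=> z; rewrite inE mem_filter => /orP[/eqP -> //|/andP[_ zs]].
  exact: sA'.
- move=> x [v]; rewrite inE => /orP[/eqP -> yx|vs vx].
    by exists y => //; rewrite inE eqxx.
  have [z zs zx] : cut_off s' x by apply: sub; exists v.
  case: (pselect (y.2 z.1)) => yz.
    exists y; first by rewrite inE eqxx.
    apply: (away_nested _ (sA' _ zs) yA yz zx) => zy.
    by case: yA => -[_ nVy _] _; apply: nVy; rewrite -zy.
  by exists z => //; rewrite inE mem_filter zs andbT; apply/orP; right; apply/asboolPn.
- move=> u v; rewrite !inE !mem_filter.
  case/orP => [/eqP ->|/andP[/asboolPn yu us]];
  case/orP => [/eqP ->|/andP[/asboolPn yv vs]] //.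
  + by case: yA => -[].
  + by move=> vy; apply: ny; exists v.
  + exact: red.
Qed.

(** The core is connected and nonempty. Finitely many [away] sets, none
    containing the centre of another, cover the complement of [O1 `|` O2];
    attaching each of them to the side that contains its centre extends a
    splitting of the core to a splitting of the whole space. The case of two
    empty sets shows that the core is not empty. *)
Lemma core_split (x0 : X) O1 O2 : open O1 -> open O2 -> O1 `&` O2 = set0 ->
  core `<=` O1 `|` O2 ->
  [\/ core `<=` O1 /\ O1 !=set0 | core `<=` O2 /\ O2 !=set0].
Proof.
move=> oO1 oO2 O12 cO.
have cC : compact (~` (O1 `|` O2)).
  apply: (subclosed_compact _ compX) => //.
  by apply: open_closedC; exact: openU.
have [||s sA sC] := compact_finite_cover x0 (D := away_pair) (f := snd) cC.
- by move=> y [[]].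
- move=> z zO; apply: contrapT => nz; apply: zO; apply: cO.
  by apply/coreP => e V aV Vz; apply: nz; exists (e, V).
have [s' [sA' sub red]] := reduce_away sA.
pose Y := ~` cut_off s'.
have YO : Y `<=` O1 `|` O2.
  move=> z Yz; apply: contrapT => zO; apply: Yz; apply: sub; exact: sC.
have cY : core `<=` Y.
  by move=> p /coreP cp [[e V] /sA' aV Vp]; exact: (cp _ _ aV).
have ctr y : y \in s' -> Y y.1 by move=> ys [z zs]; exact: red.
pose A O := (O `&` Y) `|` [set z | exists2 y, y \in s' & O y.1 /\ y.2 z].
have oA O O' : open O -> open O' -> O `&` O' = set0 -> Y `<=` O `|` O' -> open (A O).
  move=> oO oO' OO' YOO'.
  pose F := \bigcup_(y in [set` [seq y <- s' | `[< O' y.1 >]]]) (y.2 `|` [set y.1]).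
  have cF : closed F.
    apply: closed_bigcup; first exact: finite_seq.
    by move=> y /=; rewrite mem_filter => /andP[_ /sA' []]; move=> /half_closed.
  have -> : A O = (O `&` ~` F) `&` Y `|` [set z | exists2 y, y \in s' & O y.1 /\ y.2 z].
    congr (_ `|` _); apply/seteqP; split=> z; last by move=> [[]].
    move=> [ Oz Yz]; split=> //; split=> // -[y /=].
    rewrite mem_filter => /andP[/asboolP O'y ys].
    move=> [yz|zy]; first by apply: Yz; exists y.
    have : (O `&` O') z by split=> //; rewrite zy.
    by rewrite OO'.
  have -> : (O `&` ~` F) `&` Y `|` [set z | exists2 y, y \in s' & O y.1 /\ y.2 z] =
      (O `&` ~` F) `|` [set z | exists2 y, y \in s' & O y.1 /\ y.2 z].
    apply/seteqP; split=> z; first by move=> [[]|]; [left|right].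
    move=> [[ Oz nFz]|]; last by right.
    case: (pselect (Y z)) => Yz; first by left.
    move/contrapT: Yz => [y ys yz]; right; exists y => //; split=> //.
    case: (YOO' _ (ctr _ ys)) => // O'y; case: nFz; exists y; last by left.
    by rewrite /= mem_filter ys andbT; apply/asboolP.
  apply: openU; first by apply: openI => //; exact: closed_openC.
  have -> : [set z | exists2 y, y \in s' & O y.1 /\ y.2 z] =
      \bigcup_(y in [set y | y \in s' /\ O y.1]) y.2.
    apply/seteqP; split=> z [y]; first by move=> ys [ Oy yz]; exists y.
    by move=> [ys Oy] yz; exists y.
  by apply: bigcup_open => y [/sA' [[]]].
have A12 : A O1 `&` A O2 = set0.
  apply/seteqP; split=> // z [A1z A2z].
  case: A1z => [[ O1z Yz]|[y ys [ Oy yz]]].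
    by case: A2z => [[ O2z _]|[y ys [_ yz]]]; [rewrite -O12|case: Yz; exists y].
  case: A2z => [[_ Yz]|[v vs [ Ov vz]]]; first by case: Yz; exists y.
  have yv : y.1 <> v.1.
    move=> e; have : (O1 `&` O2) y.1 by split=> //; rewrite e.
    by rewrite O12.
  rewrite -(half_disjoint connX (sA' _ ys).1 (sA' _ vs).1 yv); first by [].
    exact: red.
  exact: red.
have AU : A O1 `|` A O2 = setT.
  apply/seteqP; split=> // z _; case: (pselect (Y z)) => Yz.
    by case: (YO _ Yz) => Oz; [left|right]; left.
  move/contrapT: Yz => [y ys yz].
  by case: (YO _ (ctr _ ys)) => Oy; [left|right]; right; exists y.
have AC : ~` A O1 = A O2.
  apply/seteqP; split=> z; first by have : [set: X] z by []; rewrite -AU => -[].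
  by move=> A2z A1z; have : (A O1 `&` A O2) z by []; rewrite A12.
have oA1 : open (A O1) by apply: oA O12 YO.
have oA2 : open (A O2) by apply: (oA _ O1) => //; rewrite 1?setIC 1?setUC.
have Oin O : A O x0 -> O !=set0.
  by move=> [[ Oz _]|[y _ [ Oy _]]]; [exists x0|exists y.1].
have coreA O O' : O `&` O' = set0 -> core `<=` O `|` O' -> A O = setT -> core `<=` O.
  move=> OO' cOO' AO p cp; have : A O p by rewrite AO.
  by move=> [[ Op _]|[y ys [_ yp]]] //; case: (cY _ cp); exists y.
have : [set: X] x0 by [].
rewrite -AU => -[A1|A2]; [left|right]; split; try exact: Oin.
  apply: (coreA _ O2) => //; apply: (clopen_trivial connX oA1 _ A1).
  by rewrite AC.
apply: (coreA _ O1); rewrite 1?setIC 1?setUC //.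
apply: (clopen_trivial connX oA2 _ A2).
by rewrite -AC setCK.
Qed.

Lemma core_nonempty (x0 : X) : core !=set0.
Proof.
apply: contrapT => c0.
have [||||[_ []]|[_ []]] := @core_split x0 set0 set0; rewrite ?setI0 //; try exact: open0.
by move=> p cp; case: c0; exists p.
Qed.

(** If the core is the single point [p], the rest of the space is a union of
    [away] sets. Those containing [a] have as union a clopen part of the
    complement of [p], because overlapping [away] sets lie in a common one. *)
Lemma core_singleton p a b : (forall q, core q -> q = p) -> core p ->
  a <> p -> b <> p -> sep a p b \/ exists e, sep a e (w e) /\ sep b e (w e).
Proof.
move=> pE cp ap bp.
pose W := [set z | exists2 V, (exists e, away e V) & V a /\ V z].
have cutoff z : z <> p -> exists2 V, (exists e, away e V) & V z.
  move=> zp; apply: contrapT => nz; apply: zp; apply: pE.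
  by apply/coreP => e V aV Vz; apply: nz; exists V => //; exists e.
have Wa : W a by have [V eV Va] := cutoff a ap; exists V.
have hW : half p W.
  split.
  - have -> : W = \bigcup_(V in [set V | (exists e, away e V) /\ V a]) V.
      apply/seteqP; split=> z [V]; first by move=> eV [Va Vz]; exists V.
      by move=> [eV Va] Vz; exists V.
    by apply: bigcup_open => V [[e [[]]]].
  - by move=> [V [e aV] [_ Vp]]; move/coreP: cp => /(_ _ _ aV).
  - have -> : ~` (W `|` [set p]) =
        \bigcup_(V in [set V | (exists e, away e V) /\ V `&` W = set0]) V.
      apply/seteqP; split=> z.
        move=> /not_orP[nWz /cutoff[V [e aV] Vz]]; exists V => //.
        split; first by exists e.
        apply/seteqP; split=> // y [Vy [V' [e' aV'] [V'a V'y]]]; apply: nWz.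
        have [|U eU sU] := away_overlap aV aV'; first by exists y.
        by exists U => //; split; apply: sU; [right|left].
      move=> [V [[e aV] VW] Vz] [Wz|zp].
        by have : (V `&` W) z by []; rewrite VW.
      by move/coreP: cp => /(_ _ _ aV); rewrite -zp.
    by apply: bigcup_open => V [[e [[]]]].
case: (pselect (W b)) => Wb; last by left; apply/(sepP hX); exists W.
right; have [V [e aV] [Va Vb]] := Wb; exists e.
by split; apply: (sep_sym hX); apply/awayP; exists V.
Qed.

End Orientation.

(** * Countability and the core of a metric continuum *)

Section Countability.

Lemma countable_setU (T : Type) (A B : set T) :
  countable A -> countable B -> countable (A `|` B).
Proof.
move=> cA cB; rewrite -bigcup2E; apply: bigcup_countable => // i _.
by case: i => [|[|i]] /=.
Qed.

Context {X : topologicalType}.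

Lemma countable_preimage (T U : Type) (g : T -> U) (B : set U) :
  countable B -> injective g -> countable (g @^-1` B).
Proof.
move=> /countable_injP[phi phiI] g_inj; apply/countable_injP.
exists (phi \o g) => x y /set_mem Bx /set_mem By /phiI e.
by apply: g_inj; apply: e; exact/mem_set.
Qed.

(** A basic neighbourhood inside [O y] is a label of [y] taken from a countable
    set, and two elements with the same label lie in each other's [O]. *)
Lemma countable_basic (Y : Type) (K : set Y) (x : Y -> X) (O : Y -> set X) :
  @second_countable X ->
  (forall y, K y -> open (O y) /\ O y (x y)) ->
  (forall y y', K y -> K y' -> O y (x y') -> O y' (x y) -> y = y') ->
  countable K.
Proof.
move=> [B cB [_ nB]] KO Kinj.
have lab y : exists b, K y -> [/\ B b, b (x y) & b `<=` O y].
  case: (pselect (K y)) => Ky; last by exists set0.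
  have [oO Ox] := KO y Ky.
  have [b [Bb bx] bO] := nB (x y) (O y) (open_nbhs_nbhs (conj oO Ox)).
  by exists b.
have [b bP] := choice lab.
have /countable_injP[phi phiI] := cB.
apply/countable_injP; exists (fun y => phi (b y)) => y y' /set_mem Ky /set_mem Ky' e.
have [By bx bO] := bP y Ky; have [By' bx' bO'] := bP y' Ky'.
have bb : b y = b y' by apply: phiI e; exact/mem_set.
apply: Kinj => //; first by apply: bO; rewrite bb.
by apply: bO'; rewrite -bb.
Qed.

End Countability.

Section Metric.
Context {R : realType} {X : metricType R}.
Hypothesis compX : compact [set: X].
Local Open Scope ring_scope.

Lemma compact_metric_second_countable (x0 : X) : @second_countable X.
Proof.
pose Xp : pseudoPMetricType R := HB.pack (X : Type) X (isPointed.Build (X : Type) x0).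
exact: (@compact_second_countable R Xp compX).
Qed.

Lemma open_mdist_lt (p : X) (r : R) : open [set z | mdist p z < r].
Proof.
rewrite openE => z /= zr; apply/nbhs_ballP; exists (r - mdist p z).
  by rewrite /= subr_gt0.
move=> u; rewrite ballEmdist /= => zu; apply: le_lt_trans (metric_triangle p z u) _.
by rewrite -ltrBrDl.
Qed.

Lemma open_mdist_gt (p : X) (r : R) : open [set z | r < mdist p z].
Proof.
rewrite openE => z /= zr; apply/nbhs_ballP; exists (mdist p z - r).
  by rewrite /= subr_gt0.
move=> u; rewrite ballEmdist /= => zu.
have := metric_triangle p u z; rewrite (metric_sym u z) => h.
rewrite -(ltrD2r (mdist z u)); apply: lt_le_trans h.
by rewrite -ltrBrDl.
Qed.

Lemma countable_gap (c : R) (K : set R) : 0 < c -> countable K ->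
  exists2 r, 0 < r < c & ~ K r.
Proof.
move=> c0 cK; apply: contrapT => h.
have sub : `]0, c[%classic `<=` K.
  move=> r; rewrite /= in_itv /= => rc; apply: contrapT => Kr; apply: h.
  by exists r.
have c0c : countable `]0, c[%classic.
  by apply: sub_countable cK; exact: subset_card_le.
have := countable_lebesgue_measure0 c0c.
rewrite lebesgue_measure_itv /= lte_fin c0 oppr0 adde0 => -[ce].
by rewrite ce ltxx in c0.
Qed.

Hypothesis connX : connected [set: X].

(** If all points of the core are cut points, the parts that they cut off are
    disjoint nonempty open sets, so that the core is countable. A connected set
    with two points is uncountable, its distances to one of the points filling
    an interval of the real line. Hence the core is a single point and
    [core_singleton] applies. *)
Lemma core_point (w : X -> X) (x0 : X) : (forall e, w e <> e) ->
  (forall e e', e <> e' -> sep (w e) e e' -> ~ sep (w e') e' e) ->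
  exists2 p, core w p & ~ cut_point p \/
    forall a b, a <> p -> b <> p ->
      sep a p b \/ exists e, sep a e (w e) /\ sep b e (w e).
Proof.
move=> wn wc; have hX : hausdorff_space X := @metric_hausdorff R X.
have scX := compact_metric_second_countable x0.
case: (pselect (exists2 p, core w p & ~ cut_point p)) => [[p cp np]|allcut].
  by exists p => //; left.
have [p cp] := core_nonempty hX compX connX wn wc x0.
exists p => //; right=> a b; apply: (core_singleton hX connX wn wc) => // q cq.
apply: contrapT => qp.
have awayV z : exists V, core w z -> away w z V /\ V !=set0.
  case: (pselect (core w z)) => cz; last by exists set0.
  have zcut : cut_point z by apply: contrapT => nz; apply: allcut; exists z.
  have [u /(sep_sym hX) /(sepP hX)[V [hV Vu Vw _]]] := cut_point_sep hX zcut (wn z).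
  by exists V => _; split; [split|exists u].
have [V VP] := choice awayV.
have cK : countable (core w).
  have Vx z : exists x, core w z -> V z x.
    case: (pselect (core w z)) => cz; last by exists x0.
    by have [_ [x Vx]] := VP z cz; exists x.
  have [x xP] := choice Vx.
  apply: (@countable_basic X X _ x V scX).
    move=> y cy; have [[[oV _ _] _] _] := VP y cy; split=> //; exact: xP.
  move=> y z cy cz Vz Vy; apply: contrapT => yz.
  have [ay _] := VP y cy; have [az _] := VP z cz.
  have : (V y `&` V z) (x z) by split => //; exact: xP.
  rewrite (half_disjoint connX ay.1 az.1 yz) //.
    by move/(coreP hX wn): cz => /(_ _ _ ay).
  by move/(coreP hX wn): cy => /(_ _ _ az).
have c0 : 0 < mdist p q by rewrite mdist_gt0; apply/eqP => e; exact: qp.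
have [|r /andP[r0 rc] nr] := @countable_gap _ (mdist p @` core w) c0.
  exact: card_le_trans (card_image_le _ _) cK.
have [| |[sub _]|[sub _]] := core_split hX compX connX wn wc x0
    (open_mdist_lt p r) (open_mdist_gt p r).
- by apply/seteqP; split=> // z [/= zr]; rewrite ltNge ltW.
- move=> z cz; case: (ltgtP (mdist p z) r) => [zr|zr|zr]; [by left|by right|].
  by case: nr; exists z.
- by have := sub _ cq; rewrite /= ltNge ltW.
- by have := sub _ cp; rewrite /= mdistxx ltNge ltW.
Qed.

End Metric.

(** * The pretree of cut points *)

Section PretreePoints.
Context {X : topologicalType}.
Implicit Types (a b c d e p q : X) (x y z : cut_pretree X).
Hypothesis hX : hausdorff_space X.
Hypothesis connX : connected [set: X].

Lemma cut_betweenP a c b : cut_between a c b <-> sep a c b.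
Proof. by split=> [[]//|h]; split=> //; exact: sep_cut_point h. Qed.

Lemma cut_equivP a b : cut_equiv a b <->
  a = b \/ [/\ ~ cut_point a, ~ cut_point b & forall c, ~ sep a c b].
Proof.
split=> [[->|[na nb ab]]|[->|[na nb ab]]]; [by left| |by left|].
  right; split=> // c /cut_betweenP h.
  by have : (pitv_oo cut_between a b) c by []; rewrite ab.
by right; split=> //; apply/seteqP; split=> // c /cut_betweenP /ab.
Qed.

Lemma cut_equiv_sym a b : cut_equiv a b -> cut_equiv b a.
Proof.
move=> /cut_equivP[->|[na nb ab]]; first by left.
by apply/cut_equivP; right; split=> // c /(sep_sym hX) /ab.
Qed.

Lemma sep_equiv a a' c b : cut_equiv a a' -> sep a c b -> sep a' c b.
Proof.
move=> /cut_equivP[-> //|[na na' aa']] acb.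
have [|/aa' //|//] := sep_cover hX acb (d := a').
by move=> a'c; apply: na'; rewrite a'c; exact: sep_cut_point acb.
Qed.

Lemma cut_equiv_trans a b c : cut_equiv a b -> cut_equiv b c -> cut_equiv a c.
Proof.
move=> ab bc; have /cut_equivP[-> //|[na nb sab]] := ab.
have /cut_equivP[<- //|[_ nc sbc]] := bc.
apply/cut_equivP; right; split=> // d /(sep_equiv ab); exact: sbc.
Qed.

Lemma cut_equiv_cut a b : cut_equiv a b -> cut_point a -> a = b.
Proof. by move=> /cut_equivP[//|[]]. Qed.

Definition cls a : cut_pretree X :=
  SigSub (mem_set (imageT (fun a : X => [set b | cut_equiv a b]) a)).

Lemma val_cls a : \val (cls a) = [set b | cut_equiv a b].
Proof. by []. Qed.

Lemma clsP x : exists a, x = cls a.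
Proof.
have [a _ ax] := set_valP x; exists a; apply: val_inj; exact: esym.
Qed.

Lemma cls_eq a b : cls a = cls b <-> cut_equiv a b.
Proof.
split=> [/(congr1 val)|ab].
  rewrite !val_cls => /seteqP[h _]; apply: cut_equiv_sym; apply: h; left => //.
apply: val_inj; rewrite !val_cls; apply/seteqP; split=> c /=.
  by move=> ac; apply: cut_equiv_trans ac; exact: cut_equiv_sym.
exact: cut_equiv_trans.
Qed.

Lemma is_cut_cls a : is_cut (cls a) <-> cut_point a.
Proof.
split=> [[c cc /= ac]|ca]; last by exists a => //; left.
by rewrite -(cut_equiv_cut (cut_equiv_sym ac) cc).
Qed.

Lemma cls_neq a b : cls a <> cls b -> a <> b.
Proof. by move=> ab e; apply: ab; rewrite e. Qed.

Lemma cls_cut_inj a b : cut_point a -> cls a = cls b -> a = b.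
Proof. by move=> ca /cls_eq /cut_equiv_cut; exact. Qed.

Lemma cls_sep a b : ~ cut_point a -> ~ cut_point b -> cls a <> cls b ->
  exists c, sep a c b.
Proof.
move=> na nb ab; apply: contrapT => h; apply: ab; apply/cls_eq/cut_equivP.
by right; split=> // c abc; apply: h; exists c.
Qed.

(** The cut point [e] keeps [p] away from [a]; the case [e = a] is needed when
    [a] is a cut point next to the class of [p]. *)
Definition hides p e a := [/\ cut_point e, e <> p & e = a \/ sep p e a].

(** The relation of lying in the same direction from the class of [p], whose
    negation is betweenness by [pbetween_cls]. That it is an equivalence relation
    contains all pretree axioms but one, which is [same_side_anti]. *)
Definition same_side p a b :=
  if `[< cut_point p >] then ~ sep a p b
  else exists e, hides p e a /\ hides p e b.

Lemma same_side_cut p a b : cut_point p -> same_side p a b <-> ~ sep a p b.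
Proof. by move=> cp; rewrite /same_side asboolT. Qed.

Lemma same_side_noncut p a b : ~ cut_point p ->
  same_side p a b <-> exists e, hides p e a /\ hides p e b.
Proof. by move=> cp; rewrite /same_side asboolF. Qed.

Lemma same_side_sym p a b : same_side p a b -> same_side p b a.
Proof.
case: (pselect (cut_point p)) => cp.
  by move=> /same_side_cut h; apply/same_side_cut => // /(sep_sym hX); exact: h.
by move=> /(same_side_noncut _ _ cp)[e []]; rewrite same_side_noncut //; exists e.
Qed.

Lemma same_side_refl p a : cls a <> cls p -> same_side p a a.
Proof.
case: (pselect (cut_point p)) => cp ap.
  by apply/same_side_cut => // /(sep_irrefl hX).
apply/(same_side_noncut _ _ cp).
case: (pselect (cut_point a)) => ca.
  by exists a; split; split=> //; [exact: cls_neq|left|exact: cls_neq|left].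
have [c acp] := cls_sep ca cp ap.
have cc := sep_cut_point acp.
by exists c; split; split=> //; try (by right; exact: sep_sym);
  move=> e; apply: cp; rewrite -e.
Qed.

Lemma hides_trans p e f d : hides p f d -> sep p e f -> hides p e d.
Proof.
move=> [cf fp fd] pef; split; [exact: sep_cut_point pef|exact/nesym/(sep_neq_l hX pef)|].
case: fd => [<-|pfd]; first by right.
case: (pselect (d = e)) => [->|de]; first by left.
right; have [//|def] := sep_cover hX pef de.
have ef : e <> f by move=> /esym; exact: (sep_neq_r hX pef).
have [pfe|efd] := sep_cover hX pfd ef.
  by case: (sep_anti hX connX pef).
by case: (sep_anti hX connX (sep_sym hX efd)).
Qed.

(** The cut points between [p] and [b] are linearly ordered by their distance
    from [p]; the closest of two of them hides whatever the other one does, by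
    [hides_trans]. *)
Lemma hides_total p e f b : hides p e b -> hides p f b ->
  [\/ e = f, sep p e f | sep p f e].
Proof.
move=> [ce ep eb] [cf fp fb].
case: (pselect (e = f)) => ef; first by constructor 1.
case: eb fb => [eb|peb] [fb|pfb].
- by case: ef; rewrite eb.
- by constructor 3; rewrite eb.
- by constructor 2; rewrite fb.
have [|feb] := sep_cover hX peb (nesym ef); first by constructor 2.
have [|efb] := sep_cover hX pfb ef; first by constructor 3.
by case: (sep_anti hX connX (sep_sym hX feb)); exact: sep_sym.
Qed.

Lemma same_side_trans p a b d : cls b <> cls p ->
  same_side p a b -> same_side p b d -> same_side p a d.
Proof.
move=> /cls_neq bp; case: (pselect (cut_point p)) => cp.
  move=> /(same_side_cut _ _ cp) ab /(same_side_cut _ _ cp) bd.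
  by apply/same_side_cut => // apd; case: (sep_cover hX apd bp).
move=> /(same_side_noncut _ _ cp)[e [ea eb]] /(same_side_noncut _ _ cp)[f [fb fd]].
apply/(same_side_noncut _ _ cp).
case: (hides_total eb fb) => [ef|pef|pfe].
- by exists e; split=> //; rewrite ef.
- by exists e; split=> //; exact: hides_trans pef.
- by exists f; split=> //; exact: hides_trans pfe.
Qed.

(** Betweenness does not depend on the representatives of the classes. *)
Lemma pbetween_cls a p b : pbetween (cls a) (cls p) (cls b) <->
  [/\ cls p <> cls a, cls p <> cls b & ~ same_side p a b].
Proof.
split.
  move=> [[a' [b' [c [/= aa' bb' pc cc /cut_betweenP a'cb']]]]|].
    have cp : c = p by exact: cut_equiv_cut (cut_equiv_sym pc) cc.
    have apb : sep a p b.
      rewrite -cp; apply: (sep_equiv (cut_equiv_sym aa')); apply: (sep_sym hX).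
      by apply: (sep_equiv (cut_equiv_sym bb')); exact: (sep_sym hX).
    rewrite cp in cc; split.
    - by move=> /(cls_cut_inj cc) pa; apply: (sep_neq_l hX apb).
    - by move=> /(cls_cut_inj cc) pb; apply: (sep_neq_r hX apb).
    - by move=> /(same_side_cut _ _ cc).
  move=> [np pa pb [a' [b' [c [/= aa' bb' pc h]]]]]; split=> //.
  have cp : ~ cut_point p by move=> /is_cut_cls.
  move=> /(same_side_noncut _ _ cp) [e [[ce _ ea] [_ _ eb]]].
  have a'c : a' <> c.
    move=> e'; apply: pa; apply/cls_eq; apply: (cut_equiv_trans pc).
    by rewrite -e'; exact: cut_equiv_sym.
  have cb' : c <> b'.
    move=> e'; apply: pb; apply/cls_eq; apply: (cut_equiv_trans pc).
    by rewrite e'; exact: cut_equiv_sym.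
  have : (pitv_co cut_between a' c `&` pitv_oc cut_between c b') e.
    split; split=> //.
      case: ea => [ea|pea].
        by left; rewrite ea in ce *; exact: cut_equiv_cut.
      right; apply/cut_betweenP; apply: (sep_equiv aa'); apply: (sep_sym hX).
      by apply: (sep_equiv pc).
    case: eb => [eb|peb].
      by left; rewrite eb in ce *; exact: cut_equiv_cut.
    right; apply/cut_betweenP; apply: (sep_equiv pc); apply: (sep_sym hX).
    by apply: (sep_equiv bb'); exact: (sep_sym hX).
  by rewrite h.
move=> [pa pb nab]; case: (pselect (cut_point p)) => cp.
  left; exists a, b, p; split=> //; try by left.
  by apply/cut_betweenP; apply: contrapT => h; apply: nab; apply/same_side_cut.
right; split=> //; first by move=> /is_cut_cls.
exists a, b, p; split; try by left.
apply/seteqP; split=> // e [[_ ea] [_ eb]]; apply: nab.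
have ea' : e = a \/ sep a e p by case: ea => [|/cut_betweenP]; [left|right].
have eb' : e = b \/ sep p e b by case: eb => [|/cut_betweenP]; [left|right].
case: (pselect (cut_point e)) => ce.
  have ep : e <> p by move=> ep; apply: cp; rewrite -ep.
  apply/(same_side_noncut _ _ cp); exists e; split; split=> //.
  by case: ea' => [->|/(sep_sym hX)]; [left|right].
case: ea' => [ea'|/sep_cut_point //].
case: eb' => [eb'|/sep_cut_point //].
by rewrite -eb' ea'; apply: same_side_refl; exact: nesym.
Qed.

Definition pint x y := pitv_cc (@pbetween X) x y.

Lemma pint_cls a b p : pint (cls a) (cls b) (cls p) <->
  [\/ cls p = cls a, cls p = cls b | ~ same_side p a b].
Proof.
split=> [[[|]|/pbetween_cls[]]|].
- by constructor 1.
- by constructor 2.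
- by constructor 3.
case: (pselect (cls p = cls a)) => [->|pa]; first by left; left.
case: (pselect (cls p = cls b)) => [->|pb]; first by left; right.
by case=> // nab; right; apply/pbetween_cls.
Qed.

Lemma pint_sep a b e : sep a e b -> pint (cls a) (cls b) (cls e).
Proof.
move=> aeb; apply/pint_cls; constructor 3.
by move=> /(same_side_cut _ _ (sep_cut_point aeb)); exact.
Qed.

Lemma pint_cut a b e : cut_point e -> e <> a -> e <> b ->
  pint (cls a) (cls b) (cls e) -> sep a e b.
Proof.
move=> ce ea eb /pint_cls[/(cls_cut_inj ce)//|/(cls_cut_inj ce)//|h].
by apply: contrapT => n; apply: h; apply/same_side_cut.
Qed.

Lemma pint_refl x z : pint x x z -> z = x.
Proof.
have [a ->] := clsP x; have [p ->] := clsP z.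
case: (pselect (cls p = cls a)) => // pa /pint_cls[//|//|h].
by case: h; apply: same_side_refl; exact: nesym.
Qed.

Lemma same_side_anti a p q : cls p <> cls q -> ~ same_side p a q ->
  same_side q a p.
Proof.
move=> pq np; have pq' := cls_neq pq.
case: (pselect (cut_point p)) => cp; case: (pselect (cut_point q)) => cq.
- apply/(same_side_cut _ _ cq) => aqp; apply: np.
  by apply/(same_side_cut _ _ cp); exact: sep_anti.
- have apq : sep a p q by apply: contrapT => h; apply: np; apply/same_side_cut.
  apply/(same_side_noncut _ _ cq); exists p; split; split=> //.
    by right; exact: sep_sym.
  by left.
- apply/(same_side_cut _ _ cq) => aqp; apply: np; apply/(same_side_noncut _ _ cp).
  exists q; split; split=> //; [exact: nesym|by right; exact: sep_sym|exact: nesym|by left].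
- have [e peq] := cls_sep cp cq pq; have ce := sep_cut_point peq.
  apply: contrapT => nq.
  have hpe : hides p e q.
    by split=> //; [move=> ep; apply: cp; rewrite -ep|right].
  have hqe : hides q e p.
    by split=> //; [move=> eq; apply: cq; rewrite -eq|right; exact: sep_sym].
  have npa : ~ hides p e a.
    by move=> hpa; apply: np; apply/(same_side_noncut _ _ cp); exists e.
  have nqa : ~ hides q e a.
    by move=> hqa; apply: nq; apply/(same_side_noncut _ _ cq); exists e.
  have ae : a <> e by move=> ae; apply: npa; case: hpe => ? ? _; split=> //; left.
  have [pea|aeq] := sep_cover hX peq ae.
    by apply: npa; case: hpe => ? ? _; split=> //; right.
  by apply: nqa; case: hqe => ? ? _; split=> //; right; exact: sep_sym.
Qed.

Lemma pint_pretree : interval_pretree pint.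
Proof.
split.
- exact: pint_refl.
- by move=> x y; left; left.
- move=> x y z; have [a ->] := clsP x; have [b ->] := clsP y; have [p ->] := clsP z.
  move=> /pint_cls h; apply/pint_cls; case: h => [h|h|h].
  + by constructor 2.
  + by constructor 1.
  + by constructor 3 => /same_side_sym.
- move=> x y z; have [a ->] := clsP x; have [p ->] := clsP y; have [q ->] := clsP z.
  move=> h1 h2; apply: contrapT => pq.
  case: (pselect (cls q = cls a)) => qa.
    by move: h1; rewrite qa => /pint_refl pa; apply: pq; rewrite pa qa.
  case: (pselect (cls p = cls a)) => pa.
    by move: h2; rewrite pa => /pint_refl.
  case/pint_cls: h1 => [//|//|np].
  case/pint_cls: h2 => [//|/esym//|].
  by apply; exact: same_side_anti.
- move=> x w y z; have [a ->] := clsP x; have [b ->] := clsP y.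
  have [p ->] := clsP z; have [v ->] := clsP w.
  case: (pselect (cls v = cls p)) => [->|vp]; first by left; left; right.
  move=> /pint_cls[pa|pb|h].
  + by left; apply/pint_cls; constructor 1.
  + by right; apply/pint_cls; constructor 2.
  + case: (pselect (same_side p a v)) => pav.
      right; apply/pint_cls; constructor 3 => pvb.
      by apply: h; exact: same_side_trans pav pvb.
    by left; apply/pint_cls; constructor 3.
Qed.

(** Classes of points that are not cut points are told apart by a cut point, by
    the definition of the equivalence relation. *)
Lemma pint_has_cut x y : x <> y -> exists2 e, cut_point e & pint x y (cls e).
Proof.
have [a ->] := clsP x; have [b ->] := clsP y => ab.
case: (pselect (cut_point a)) => ca; first by exists a => //; left; left.
case: (pselect (cut_point b)) => cb; first by exists b => //; left; right.
have [e aeb] := cls_sep ca cb ab.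
by exists e; [exact: sep_cut_point aeb|exact: pint_sep].
Qed.

End PretreePoints.

(** * Medians and completeness of the cut point pretree *)

Section PretreeComplete.
Context {R : realType} {X : metricType R}.
Implicit Types (a b c d e p q : X) (x y z : cut_pretree X).
Hypothesis compX : compact [set: X].
Hypothesis connX : connected [set: X].

Let hX : hausdorff_space X := @metric_hausdorff R X.
Let IP := pint_pretree hX connX.

Lemma two_of_three (A B C A' B' C' : Prop) :
  [\/ A /\ B, B /\ C | A /\ C] -> [\/ A' /\ B', B' /\ C' | A' /\ C'] ->
  [\/ A /\ A', B /\ B' | C /\ C'].
Proof.
by case=> -[? ?] [] -[? ?];
  solve [by constructor 1 | by constructor 2 | by constructor 3].
Qed.

(** Unless some point keeps all three apart, every point [e] has two of the
    three on the same side, and this majority is the preferred direction [w e].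
    Two majorities share one of the three points, which makes the directions
    coherent. By [core_point] the core has a point that is not a cut point, since
    no [away] set contains two of the three points, and it represents the
    median. *)
Lemma pretree_median x y z : exists m, [/\ pint x y m, pint y z m & pint x z m].
Proof.
have lft := ipt_left IP; have rgt := ipt_right IP.
case: (pselect (x = y)) => [<-|xy]; first by exists x; split.
case: (pselect (y = z)) => [<-|yz]; first by exists y; split.
case: (pselect (x = z)) => [<-|xz]; first by exists x; split.
have [a xa] := clsP x; have [b yb] := clsP y; have [c zc] := clsP z.
subst x y z.
have ab := cls_neq xy; have bc := cls_neq yz; have ac := cls_neq xz.
pose all_apart e := [/\ e <> a -> e <> b -> sep a e b, e <> b -> e <> c -> sep b e c
  & e <> a -> e <> c -> sep a e c].
case: (pselect (exists e, all_apart e)) => [[e [eab ebc eac]]|nmed].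
  exists (cls e).
  have I_ u v : (e <> u -> e <> v -> sep u e v) -> pint (cls u) (cls v) (cls e).
    case: (pselect (e = u)) => [-> //|eu].
    case: (pselect (e = v)) => [-> //|ev] h.
    by apply: (pint_sep hX); exact: h.
  by split; apply: I_.
pose maj u e t := t <> e /\ ~ sep u e t.
have wP e : exists u, u <> e /\
    [\/ maj u e a /\ maj u e b, maj u e b /\ maj u e c | maj u e a /\ maj u e c].
  apply: contrapT => h; apply: nmed; exists e.
  have irr u : ~ sep u e u by exact: sep_irrefl.
  split=> e1 e2; apply: contrapT => nse; apply: h.
  - by exists a; split; [exact/nesym|constructor 1; split; split=> //; exact: nesym].
  - by exists b; split; [exact/nesym|constructor 2; split; split=> //; exact: nesym].
  - by exists a; split; [exact/nesym|constructor 3; split; split=> //; exact: nesym].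
have [w wmaj] := choice wP.
have wn e : w e <> e by case: (wmaj e).
have wc e e' : e <> e' -> sep (w e) e e' -> ~ sep (w e') e' e.
  move=> ee' s s'; have [_ m] := wmaj e; have [_ m'] := wmaj e'.
  suff h t : maj (w e) e t /\ maj (w e') e' t -> False.
    by case: (two_of_three m m'); exact: h.
  move=> [[te nt] [te' nt']].
  have [//|tee'] := sep_cover hX s te.
  have [//|te'e] := sep_cover hX s' te'.
  exact: (sep_anti hX connX tee').
have [p cp pP] := core_point compX connX a wn wc.
have nhide e t : hides p e t -> ~ maj (w e) e t.
  move=> [ce ep [et|pet]] [te nt]; first by apply: te.
  by case: (sep_cover hX pet (wn e)) => // /(sep_sym hX); exact: cp.
(* e would hide p from two points, one of which is in the majority at e *)
have nhide2 e : ~ [\/ hides p e a /\ hides p e b, hides p e b /\ hides p e c |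
    hides p e a /\ hides p e c].
  move=> h; have [_ m] := wmaj e.
  by case: (two_of_three h m) => -[/nhide].
case: (pselect (cut_point p)) => cutp; last first.
  have I_ u v : (forall e, ~ (hides p e u /\ hides p e v)) ->
      pint (cls u) (cls v) (cls p).
    move=> h; apply/(pint_cls hX); constructor 3.
    by move=> /(same_side_noncut _ _ cutp)[e]; exact: h.
  exists (cls p); split; apply: I_ => e h; apply: (nhide2 e).
  - by constructor 1.
  - by constructor 2.
  - by constructor 3.
case: pP => // pP; exfalso.
have key u v : maj (w p) p u /\ maj (w p) p v ->
    (forall e, maj (w e) e u \/ maj (w e) e v) -> False.
  move=> [[up nu] [vp nv]] h; case: (pP u v up vp) => [upv|[e [ue ve]]].
    by case: (sep_cover hX upv (wn p)) => // /(sep_sym hX).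
  by case: (h e) => -[_]; apply; exact: (sep_sym hX).
have [_ m] := wmaj p.
case: m => m; apply: (key _ _ m) => e; have [_ me] := wmaj e;
  case: me => -[h h']; solve [by left | by right].
Qed.


(** A lower part without maximum has a cut point beyond each of its elements. *)
Lemma cut_after x y s L : ~ L y -> initial_segment pint x y L ->
  (forall m, pint x y m -> L m ->
    exists t, [/\ pint x y t, L t, pint x t m & t <> m]) ->
  pint x y s -> L s ->
  exists e, [/\ cut_point e, pint x y (cls e), L (cls e), pint x (cls e) s &
    cls e <> s].
Proof.
move=> Ly iL nomax xys Ls.
have [t [xyt Lt xts ts]] := nomax s xys Ls.
have [u [xyu Lu xut ut]] := nomax t xyt Lt.
have [e ce tue] := pint_has_cut hX (nesym ut).
have xue : pint x u (cls e) by exact: (ipt_sub_r IP xut).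
have xye : pint x y (cls e) by exact: (ipt_sub IP xyu).
have xet : pint x (cls e) t.
  by apply: (ipt_sym IP); exact: (ipt_swap IP (ipt_sym IP xut) (ipt_sym IP tue)).
have xes : pint x (cls e) s by exact: (ipt_sub IP xet).
exists e; split=> //; first exact: (iL u).
by move=> es; apply: ts; apply: (ipt_anti IP _ xts); rewrite -es.
Qed.

(** Suppose that the cut is a gap. The preferred direction is the end [b] at the
    points below the gap and the end [a] elsewhere. The core then lies above
    everything below the gap and below everything above it; a point of the core
    that is not a cut point would be an element of [x, y] in the gap, and a
    single cut point would separate [a] from [b], hence be such an element
    too. *)
Lemma pretree_complete x y : interval_complete pint x y.
Proof.
have lft := ipt_left IP; have rgt := ipt_right IP.
move=> L iL Lx Ly; apply: contrapT => nocut.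
have nomax m : pint x y m -> L m ->
    exists t, [/\ pint x y t, L t, pint x t m & t <> m].
  move=> xym Lm; apply: contrapT => h; apply: nocut; exists m; split=> // t xyt.
  case: (ipt_total IP xyt xym) => [xtm|xmt]; split=> Lt //.
    by case: (pselect (t = m)) => [->|tm]; [exact: rgt|case: h; exists t].
  by case: Lt; exact: (iL m t).
have nomin m : pint y x m -> ~ L m ->
    exists t, [/\ pint y x t, ~ L t, pint y t m & t <> m].
  move=> yxm Lm; have xym := ipt_sym IP yxm.
  apply: contrapT => h; apply: nocut; exists m; split=> // t xyt.
  have yxt := ipt_sym IP xyt.
  case: (ipt_total IP yxt yxm) => [ytm|ymt]; split=> Lt.
  - exact: (ipt_sym IP (ipt_swap IP yxt ytm)).
  - case: (pselect (t = m)) => [->|tm]; first exact: rgt.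
    by case: h; exists t.
  - by case: Lm; apply: (iL t m xyt Lt); exact: (ipt_sym IP (ipt_swap IP yxm ymt)).
  - exact: (ipt_sym IP (ipt_swap IP yxm ymt)).
have iN : initial_segment pint y x (~` L).
  move=> t s yxt Lt yts Ls; apply: Lt.
  have yxs : pint y x s by exact: (ipt_sub IP yxt).
  apply: (iL s t (ipt_sym IP yxs) Ls).
  exact: (ipt_sym IP (ipt_swap IP yxt yts)).
have [a xa] := clsP x; have [b yb] := clsP y; subst x y.
have ab : a <> b by move=> e; apply: Ly; rewrite -e.
pose I := pint (cls a) (cls b).
pose low e := I (cls e) /\ L (cls e).
pose w e := if `[< low e >] then b else a.
have w_low e : low e -> w e = b by move=> h; rewrite /w asboolT.
have w_high e : ~ low e -> w e = a by move=> h; rewrite /w asboolF.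
have wn e : w e <> e.
  case: (pselect (low e)) => le.
    by rewrite w_low // => be; apply: Ly; rewrite be; case: le.
  rewrite w_high // => ae; apply: le; rewrite -ae; split=> //; exact: lft.
have coh e e' : low e -> ~ low e' -> sep b e e' -> ~ sep a e' e.
  move=> le le' bee' ae'e.
  have ce := sep_cut_point bee'; have ce' := sep_cut_point ae'e.
  have ee' := sep_neq_l hX (sep_sym hX bee').
  case: (pselect (I (cls e'))) => Ie'.
    have Le' : ~ L (cls e') by move=> h; apply: le'.
    have ae_e : pint (cls a) (cls e') (cls e).
      case: (ipt_total IP Ie' le.1) => // h.
      by case: Le'; apply: (iL _ _ le.1 le.2).
    case: (pselect (e = a)) => [ea|ea].
      by move: ae'e; rewrite ea; exact: sep_irrefl.
    have := pint_cut hX ce ea (nesym ee') ae_e.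
    by move=> /(sep_anti hX connX); apply.
  have e'b : b <> e' by move=> be'; apply: Ie'; rewrite -be'; exact: rgt.
  case: (sep_cover hX ae'e e'b) => [ae'b|be'e].
    by apply: Ie'; exact: (pint_sep hX).
  exact: (sep_anti hX connX bee').
have wc e e' : e <> e' -> sep (w e) e e' -> ~ sep (w e') e' e.
  move=> ee'; case: (pselect (low e)) => le; case: (pselect (low e')) => le'.
  - by rewrite !w_low //; exact: sep_anti.
  - by rewrite (w_low e) // (w_high e') //; exact: coh.
  - by rewrite (w_low e') // (w_high e) // => h1 h2; exact: (coh e' e) h2 h1.
  - by rewrite !w_high //; exact: sep_anti.
have [p cp pP] := core_point compX connX a wn wc.
(* a cut point further up keeps b away from e, but not from the core *)
have lowP e : low e -> cut_point e -> p <> e.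
  move=> le ce pe.
  have [f [cf If Lf aef fe]] := cut_after Ly iL nomax le.1 le.2.
  have fb : f <> b by move=> fb; apply: Ly; rewrite -fb.
  apply: (cp f); rewrite w_low //; apply: (sep_sym hX); rewrite pe.
  apply: (pint_cut hX) => //; first by move=> h; apply: fe; rewrite h.
  exact: (ipt_swap IP If).
have highP e : I (cls e) -> ~ low e -> cut_point e -> p <> e.
  move=> Ie le ce pe; have Le : ~ L (cls e) by move=> h; apply: le.
  have [|||f [cf If Lf bef fe]] := @cut_after (cls b) (cls a) (cls e) (~` L) _ iN nomin.
  - by apply.
  - exact: (ipt_sym IP).
  - by [].
  have fa : f <> a by move=> fa; apply: Lf; rewrite fa.
  apply: (cp f); rewrite w_high; last by move=> [_ /Lf].
  apply: (sep_sym hX); rewrite pe.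
  apply: (pint_cut hX) => //; first by move=> h; apply: fe; rewrite h.
  exact: (ipt_swap IP If).
case: (pselect (cut_point p)) => cutp.
  case: pP => // pP.
  have pa : a <> p.
    move=> e; apply: (lowP p) => //; split; first by rewrite -e; exact: lft.
    by rewrite -e.
  have pb : b <> p.
    move=> e; apply: (highP p) => //; first by rewrite -e; exact: rgt.
    by move=> [_]; rewrite -e.
  case: (pP a b pa pb) => [/(pint_sep hX) Ip|[e [ae be]]].
    case: (pselect (low p)) => lp; first exact: (lowP p).
    exact: (highP p).
  case: (pselect (low e)) => le.
    by move: be; rewrite w_low //; exact: sep_irrefl.
  by move: ae; rewrite w_high //; exact: sep_irrefl.
have Ip : I (cls p).
  apply/(pint_cls hX); constructor 3 => /(same_side_noncut _ _ cutp).
  move=> [e [[ce ep ea] [_ _ eb]]].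
  case: (pselect (low e)) => le.
    case: eb => [eb|/(sep_sym hX)]; first by case: le => _; rewrite eb.
    by have := cp e; rewrite w_low.
  case: ea => [ea|/(sep_sym hX)]; last by have := cp e; rewrite w_high.
  by apply: le; rewrite ea; split=> //; exact: lft.
case: (pselect (L (cls p))) => Lp.
  have [f [cf If Lf afp fp]] := cut_after Ly iL nomax Ip Lp.
  have fb : f <> b by move=> fb; apply: Ly; rewrite -fb.
  apply: (cp f); rewrite w_low //; apply: (sep_sym hX).
  apply: (pint_cut hX) => //; first by move=> h; apply: fp; rewrite h.
  exact: (ipt_swap IP If).
have [|||f [cf If Lf bfp fp]] := @cut_after (cls b) (cls a) (cls p) (~` L) _ iN nomin.
- by apply.
- exact: (ipt_sym IP).
- by [].
have fa : f <> a by move=> fa; apply: Lf; rewrite fa.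
apply: (cp f); rewrite w_high; last by move=> [_ /Lf].
apply: (sep_sym hX).
apply: (pint_cut hX) => //; first by move=> h; apply: fp; rewrite h.
exact: (ipt_swap IP If).
Qed.

End PretreeComplete.

(** * Preseparability *)

Section PretreeSeparable.
Context {R : realType} {X : metricType R}.
Implicit Types (a b c d e p q : X) (x y z u v t : cut_pretree X).
Hypothesis compX : compact [set: X].
Hypothesis connX : connected [set: X].

Let hX : hausdorff_space X := @metric_hausdorff R X.
Let IP := pint_pretree hX connX.

Definition pre_cut x y u := exists d, [/\ cut_point d, pint x y (cls d),
  pint x (cls d) u, u <> cls d & pint u (cls d) `<=` [set u; cls d]].

(** The side of the cut point [d] that contains its immediate predecessor [u] is
    a neighbourhood of [u] that misses all later elements of [x, y]. Elements
    that are isolated on one side in this way are countably many. *)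
Lemma countable_pre_cut x y : countable (pre_cut x y).
Proof.
have [a0 xa] := clsP x; have scX := compact_metric_second_countable compX a0.
have [rep repP] := choice (@clsP X).
have nb u : exists O : set X, pre_cut x y u -> [/\ open O, O (rep u) &
    forall t, pint x y t -> pint x t u -> t <> u -> ~ O (rep t)].
  case: (pselect (pre_cut x y u)) => [pu|npu]; last by exists set0.
  have [d [cd xyd xdu ud adj]] := pu.
  have later t : pint x y t -> pint x t u -> t <> u -> pint x t (cls d).
    move=> xyt xtu tu; case: (ipt_total IP xyt xyd) => // xdt.
    have udt : pint u (cls d) t by exact: (ipt_swap IP xdt xtu).
    by case: (adj t udt) => [//|->]; exact: (ipt_right IP).
  have [b yb] := clsP y.
  have rud : rep u <> d by move=> e; apply: ud; rewrite (repP u) e.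
  case: (pselect (d = b)) => db.
    exists (~` [set d]) => _; split=> //.
      apply: closed_openC; exact/accessible_closed_set1/hausdorff_accessible.
    move=> t xyt xtu tu h; apply: h => /=.
    have td : t = cls d.
      by apply: (ipt_anti IP _ (later t xyt xtu tu)); rewrite db -yb.
    by apply/esym; apply: (cls_cut_inj hX cd); rewrite -repP.
  have : sep (rep u) d b.
    apply: (pint_cut hX) => //; [exact: nesym|rewrite -repP -yb].
    exact: (ipt_swap IP xyd xdu).
  move=> /(sepP hX)[V [hV Vu Vb _]]; exists V => _; split=> //; first by case: hV.
  move=> t xyt xtu tu Vt; have xtd := later t xyt xtu tu.
  have tdb : sep (rep t) d b by apply/(sepP hX); exists V; split=> //; exact: nesym.
  have := pint_sep hX tdb; rewrite -repP -yb => tyd.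
  have dyt := ipt_swap IP xyt xtd.
  have td : t = cls d by exact: (ipt_anti IP (ipt_sym IP dyt) (ipt_sym IP tyd)).
  case: hV => _ Vd _; apply: Vd.
  by rewrite (cls_cut_inj hX cd (etrans (esym td) (repP t))).
have [ O OP] := choice nb.
have inI u : pre_cut x y u -> pint x y u.
  by move=> [d [_ xyd xdu _ _]]; exact: (ipt_sub IP xyd).
apply: (@countable_basic X _ _ rep O scX).
  by move=> u /OP[].
move=> u u' pu pu' Ou' Ou; apply: contrapT => uu'.
have [_ _ h] := OP u pu; have [_ _ h'] := OP u' pu'.
case: (ipt_total IP (inI u pu) (inI u' pu')) => xu.
  by apply: (h' u) => //; exact: inI.
by apply: (h u') => //; [exact: inI|exact: nesym].
Qed.

(** If the interval from [u] to [v] has cut points [c < e < d] inside, then [e]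
    lies in an open set, the part of the space between [c] and [d], all of whose
    cut points between [a] and [b] are between [c] and [d]; so that a countable
    dense set of cut points meets the interval. Otherwise the interval contains
    two adjacent elements, one of which is a cut point, and [countable_pre_cut]
    provides the other one. *)
Lemma dense_cuts x y : exists2 Q : set (cut_pretree X), countable Q &
  forall u v, pint x y u -> pint x y v -> u <> v -> pint u v `&` Q !=set0.
Proof.
have [a xa] := clsP x; have [b yb] := clsP y.
have [B cB [oB nB]] := compact_metric_second_countable compX a.
have pk (U : set X) : exists e, (exists2 e, U e & sep a e b) -> U e /\ sep a e b.
  case: (pselect (exists2 e, U e & sep a e b)) => [[e Ue se]|nU].
    by exists e.
  by exists a.
have [pick pickP] := choice pk.
pose Q := [set cls (pick U) | U in B] `|` (pre_cut x y `|` pre_cut y x).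
exists Q.
  apply: countable_setU; first exact: card_le_trans (card_image_le _ _) cB.
  by apply: countable_setU; exact: countable_pre_cut.
move=> u v xyu xyv uv.
wlog xvu : u v xyu xyv uv / pint x v u.
  move=> H; case: (ipt_total IP xyu xyv) => h; last exact: H.
  have [w [vuw Qw]] := H v u xyv xyu (nesym uv) h.
  by exists w; split=> //; exact: (ipt_sym IP).
apply: contrapT => nQ.
have uvxy := ipt_convex IP xyu xyv.
(* adjacent elements of [u, v] would put one of them into the second part of Q *)
have strict s t : pint u v s -> pint u v t -> s <> t -> pint x t s ->
    exists r, [/\ pint s t r, r <> s & r <> t].
  move=> uvs uvt st xts; apply: contrapT => h.
  have adj : pint s t `<=` [set s; t].
    move=> r str; apply: contrapT => /not_orP[rs rt].
    by apply: h; exists r.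
  have [e ce ste] := pint_has_cut hX st.
  apply: nQ; case: (adj _ ste) => /= es.
    exists t; split=> //; right; right; exists e; rewrite es; split=> //.
    - exact: (ipt_sym IP (uvxy _ uvs)).
    - exact: (ipt_sym IP (ipt_swap IP (uvxy _ uvt) xts)).
    - exact: nesym.
    - by move=> r /(ipt_sym IP) /adj []; [right|left].
  exists s; split=> //; right; left; exists e; rewrite es; split=> //.
  exact: uvxy.
(* the second element r' leaves room for a cut point different from s and t *)
have strict_cut s t : pint u v s -> pint u v t -> s <> t -> pint x t s ->
    exists e, [/\ cut_point e, pint s t (cls e), cls e <> s & cls e <> t].
  move=> uvs uvt st xts.
  have [r [str rs rt]] := strict s t uvs uvt st xts.
  have uvr : pint u v r by exact: (ipt_convex IP uvs uvt).
  have xtr : pint x t r by exact: (ipt_sub_r IP xts).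
  have xrs : pint x r s.
    by apply: (ipt_sym IP); exact: (ipt_swap IP (ipt_sym IP xts) (ipt_sym IP str)).
  have [r' [srr' r's r'r]] := strict s r uvs uvr (nesym rs) xrs.
  have [e ce ere] := pint_has_cut hX r'r.
  have sre : pint s r (cls e) by exact: (ipt_sub_r IP srr').
  exists e; split=> //.
  - exact: (ipt_sub IP str).
  - move=> es; apply: r's; apply: (ipt_refl IP); rewrite -{2}es.
    by apply: (ipt_sym IP); exact: (ipt_swap IP (ipt_sym IP srr') (ipt_sym IP ere)).
  - by move=> et; apply: rt; apply: (ipt_anti IP str); rewrite -et.
have uvu := ipt_left IP u v; have uvv := ipt_right IP u v.
have [c [cc uvc cu cv]] := strict_cut u v uvu uvv uv xvu.
have xvc : pint x v (cls c) by exact: (ipt_sub_r IP xvu).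
have xcu : pint x (cls c) u.
  by apply: (ipt_sym IP); exact: (ipt_swap IP (ipt_sym IP xvu) (ipt_sym IP uvc)).
have [e [ce cve ec ev]] := strict_cut (cls c) v uvc uvv cv xvc.
have uve : pint u v (cls e) by exact: (ipt_convex IP uvc uvv).
have xve : pint x v (cls e) by exact: (ipt_sub IP xvc) || exact: (ipt_sub_r IP xvc).
have xec : pint x (cls e) (cls c).
  by apply: (ipt_sym IP); exact: (ipt_swap IP (ipt_sym IP xvc) (ipt_sym IP cve)).
have [d [cd evd de dv]] := strict_cut (cls e) v uve uvv ev xve.
have uvd : pint u v (cls d) by exact: (ipt_convex IP uve uvv).
have xde : pint x (cls d) (cls e).
  by apply: (ipt_sym IP); exact: (ipt_swap IP (ipt_sym IP xve) (ipt_sym IP evd)).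
have xyc := uvxy _ uvc; have xye := uvxy _ uve; have xyd := uvxy _ uvd.
have xvd : pint x v (cls d) by exact: (ipt_sub_r IP xve).
have neq (z z' : X) : cls z <> cls z' -> z <> z' by exact: cls_neq.
(* no element strictly between u and v is an end of [x, y] *)
have not_a (z : X) z' : pint x (cls z) z' -> z' <> cls z -> z <> a.
  by move=> h zz' za; apply: zz'; move: h; rewrite za -xa => /(ipt_refl IP).
have not_b (z : X) z' : pint x z' (cls z) -> pint x y z' -> cls z <> z' -> z <> b.
  move=> h xyz' zz' zb; apply: zz'; rewrite zb -yb in h *.
  exact: (ipt_anti IP h xyz').
have aec : sep a c e.
  apply: (pint_cut hX) => //; [exact: not_a xcu (nesym cu)|exact/nesym/neq|].
  by rewrite -xa.
have edb : sep e d b.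
  apply: (pint_cut hX) => //; [exact: neq|exact: not_b xvd xyv dv|].
  by rewrite -yb; exact: (ipt_swap IP xyd xde).
have aeb : sep a e b.
  apply: (pint_cut hX) => //; [exact: not_a xec (nesym ec)|exact: not_b xve xyv ev|].
  by rewrite -xa -yb.
have /(sepP hX)[V [hV Ve Va _]] := sep_sym hX aec.
have /(sepP hX)[U [hU Ue Ub _]] := edb.
have oVU : open (V `&` U) by case: hV hU => ? _ _ [? _ _]; exact: openI.
have [N [BN Ne] NVU] := nB e (V `&` U) (open_nbhs_nbhs (conj oVU (conj Ve Ue))).
have [|Np asb] := pickP N; first by exists e.
set f := pick N in Np asb.
have [Vf Uf] := NVU _ Np.
have acf : sep a c f.
  by apply: (sep_sym hX); apply/(sepP hX); exists V; split=> //; exact: (sep_neq_l hX aec).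
have fdb : sep f d b.
  by apply/(sepP hX); exists U; split=> //; exact: (sep_neq_r hX edb).
have xyf : pint x y (cls f) by rewrite xa yb; exact: (pint_sep hX).
have xfc : pint x (cls f) (cls c) by rewrite xa; exact: (pint_sep hX).
have fyd : pint (cls f) y (cls d) by rewrite yb; exact: (pint_sep hX).
have xdf : pint x (cls d) (cls f).
  by apply: (ipt_sym IP); exact: (ipt_swap IP (ipt_sym IP xyf) (ipt_sym IP fyd)).
apply: nQ; exists (cls f); split; last by left; exists N.
apply: (ipt_swap IP); first exact: (ipt_sub IP xvd).
exact: (ipt_sub IP xfc).
Qed.

Lemma pretree_preseparable : preseparable (@pbetween X).
Proof.
move=> I [x [y xyI]]; have [Q cQ dQ] := dense_cuts x y.
have IJ : I `<=` pint x y.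
  case: xyI => -> z.
  - by right.
  - by move=> [_ [->|]]; [left; left|right].
  - by move=> [_ [->|]]; [left; right|right].
  - by [].
exists (Q `&` I); split.
- by move=> z [].
- by apply: sub_countable cQ; apply: subset_card_le; exact: subIsetl.
move=> u v uvI [s [t [uvs uvt st]]].
have uv : u <> v.
  by move=> uv; apply: st; rewrite -uv in uvs uvt;
    rewrite (ipt_refl IP uvs) (ipt_refl IP uvt).
have [|||w [uvw Qw]] := dQ u v => //.
- by apply/IJ/uvI; left; left.
- by apply/IJ/uvI; left; right.
by exists w; split=> //; split=> //; exact: uvI.
Qed.

End PretreeSeparable.

(** * Intervals of the cut point tree *)

Section Tree.
Context {R : realType} {X : topologicalType}.
Local Open Scope ring_scope.
Local Notation P := (cut_pretree X).
Local Notation T := (cut_tree R X).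
Implicit Types (x y z u v : P) (e f g : edge X) (p q r s : T) (t i j : unit_itv R).
Hypothesis IP : interval_pretree (@pint X).
Hypothesis strict : forall x z y, pbetween x z y -> z <> x /\ z <> y.
Hypothesis median : forall x y z, exists m, [/\ pint x y m, pint y z m & pint x z m].

Let lft := ipt_left IP.
Let rgt := ipt_right IP.

Lemma edgeP e : adjacent_in pbetween (end0 e) (end1 e) /\
  \val e = [set end0 e; end1 e].
Proof. exact: (svalP (cid (set_valP e))). Qed.

Lemma edge_neq e : end0 e <> end1 e.
Proof. by have [[]] := edgeP e. Qed.

Lemma edge_pint e z : pint (end0 e) (end1 e) z -> z = end0 e \/ z = end1 e.
Proof.
have [[_ h] _] := edgeP e; case=> [[->|->]|]; [by left|by right|].
by rewrite h.
Qed.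

Lemma edge_ends e z : \val e z <-> z = end0 e \/ z = end1 e.
Proof. by have [_ ->] := edgeP e. Qed.

Lemma edge_set e u v : \val e u -> \val e v -> u <> v -> \val e = [set u; v].
Proof.
have [_ ->] := edgeP e.
by case=> -> [] -> // _; rewrite setUC.
Qed.

Lemma edge_eq e f u v : \val e u -> \val f u -> \val e v -> \val f v -> u <> v ->
  e = f.
Proof.
move=> eu fu ev fv uv; apply: val_inj.
by rewrite (edge_set eu ev uv) (edge_set fu fv uv).
Qed.

Lemma edge_end0 e : \val e (end0 e).
Proof. by apply/edge_ends; left. Qed.

Lemma edge_end1 e : \val e (end1 e).
Proof. by apply/edge_ends; right. Qed.

Lemma unit_itvP t : 0 < \val t < 1.
Proof. by have := set_valP t; rewrite /= in_itv. Qed.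

(** The median of [x] and the two ends of [e] is one of the ends; its
    coordinate on [e] is 0 for [end0 e] and 1 for [end1 e]. *)
Definition vertex_coord e x : R := if `[< pint x (end1 e) (end0 e) >] then 0 else 1.

Lemma vertex_coord0 e x : vertex_coord e x = 0 <-> pint x (end1 e) (end0 e).
Proof.
rewrite /vertex_coord; case: asboolP => h; split=> // /eqP.
by rewrite oner_eq0.
Qed.

Lemma vertex_coord1 e x : vertex_coord e x = 1 <-> pint x (end0 e) (end1 e).
Proof.
rewrite /vertex_coord; case: asboolP => h; split=> //.
- by move=> /eqP; rewrite eq_sym oner_eq0.
- by move=> h'; case: (edge_neq (ipt_anti IP h h')).
move=> _; have [m [xm0 m01 xm1]] := median x (end0 e) (end1 e).
by case: (edge_pint m01) => me; subst m.
Qed.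

Lemma vertex_coord01 e x : vertex_coord e x = 0 \/ vertex_coord e x = 1.
Proof. by rewrite /vertex_coord; case: ifP; [left|right]. Qed.

Lemma vertex_coord_end0 e : vertex_coord e (end0 e) = 0.
Proof. exact/vertex_coord0. Qed.

Lemma vertex_coord_end1 e : vertex_coord e (end1 e) = 1.
Proof. exact/vertex_coord1. Qed.

(** An edge lies between [x] and [y] exactly if it has them on different
    sides. *)
Lemma crosses e x y : vertex_coord e x <> vertex_coord e y <->
  pint x y (end0 e) /\ pint x y (end1 e).
Proof.
have key x' y' : vertex_coord e x' = 0 -> vertex_coord e y' = 1 ->
    pint x' y' (end0 e) /\ pint x' y' (end1 e).
  move=> /vertex_coord0 hx /vertex_coord1 hy.
  split.
    case: (ipt_cover IP y' hx) => // h.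
    by case: (edge_neq (ipt_anti IP h hy)).
  case: (ipt_cover IP x' hy) => [|h]; first exact: (ipt_sym IP).
  by case: (edge_neq (ipt_anti IP hx h)).
split.
  case: (vertex_coord01 e x) => hx; case: (vertex_coord01 e y) => hy.
  - by rewrite hx hy.
  - by move=> _; exact: key.
  - by move=> _; have [] := key _ _ hy hx; split; exact: (ipt_sym IP).
  - by rewrite hx hy.
move=> [h0 h1] xy; case: (vertex_coord01 e x) => hx; have hy := hx; rewrite xy in hy.
  move/vertex_coord0: hx => hx; move/vertex_coord0: hy => hy.
  case: (ipt_cover IP (end0 e) h1) => h; first exact: (edge_neq (ipt_anti IP hx h)).
  by apply: (edge_neq (ipt_anti IP hy _)); exact: (ipt_sym IP).
move/vertex_coord1: hx => hx; move/vertex_coord1: hy => hy.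
case: (ipt_cover IP (end1 e) h0) => h; first exact: (edge_neq (ipt_anti IP h hx)).
by apply: (edge_neq (ipt_anti IP _ hy)); exact: (ipt_sym IP).
Qed.

(** Both ends of another edge are on the same side of [e], since no interval
    between them can contain [e]. *)
Lemma vertex_coord_edge e f : f <> e ->
  vertex_coord e (end0 f) = vertex_coord e (end1 f).
Proof.
move=> fe; apply: contrapT => /crosses [/edge_pint /edge_ends h0 /edge_pint /edge_ends h1].
by apply: fe; exact: (edge_eq h0 (edge_end0 e) h1 (edge_end1 e) (@edge_neq e)).
Qed.

(** The retraction of the tree onto the closed edge [e], seen as [0, 1]. *)
Definition coord e p : R :=
  match p with
  | inl x => vertex_coord e x
  | inr (f, t) => if f == e then \val t else vertex_coord e (end0 f)
  end.

Definition on_edge e p := exists t, p = inr (e, t).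

Lemma coord_on e t : coord e (inr (e, t)) = \val t.
Proof. by rewrite /= eqxx. Qed.

Lemma coord_off e p x : ~ on_edge e p -> ends p x -> coord e p = vertex_coord e x.
Proof.
case: p => [y _ -> //|[f t] nf /edge_ends h] /=.
have fe : f <> e by move=> fe; apply: nf; exists t; rewrite fe.
by case: eqP => // _; case: h => -> //; exact: vertex_coord_edge.
Qed.

Lemma ends_nonempty p : exists x, ends p x.
Proof.
by case: p => [x|[e t]]; [exists x|exists (end0 e); apply/edge_ends; left].
Qed.

Lemma coord_off01 e p : ~ on_edge e p -> coord e p = 0 \/ coord e p = 1.
Proof.
move=> np; have [x px] := ends_nonempty p; rewrite (coord_off np px).
exact: vertex_coord01.
Qed.

Definition between_r (a c b : R) := (a <= c <= b) \/ (b <= c <= a).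

(** A vertex is between [p] and [r] if it is between all their ends, and a point
    of an edge [e] is if it is between their retractions on [e]. In this form,
    which is equivalent to the description by routes by [tint_citv], the axioms
    follow from those of the pretree and from the order of the real line. *)
Definition tint p r : set T := [set q | match q with
  | inl z => forall x y, ends p x -> ends r y -> pint x y z
  | inr (e, t) => between_r (coord e p) (\val t) (coord e r)
  end].

Lemma between_r_inside (a b : R) t : (a = 0 \/ a = 1) -> (b = 0 \/ b = 1) ->
  between_r a (\val t) b -> a <> b.
Proof.
have := unit_itvP t => /andP[t0 t1] ha _ h ab; rewrite -{}ab in h.
by case: h => /andP[h h']; case: ha => ha; rewrite ha in h h'; lra.
Qed.

Lemma between_r_01 t (a b : R) : (a = 0 \/ a = 1) -> (b = 0 \/ b = 1) -> a <> b ->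
  between_r a (\val t) b.
Proof.
have := unit_itvP t => /andP[/ltW t0 /ltW t1] [->|->] [->|->] ab.
- by case: ab.
- by left; rewrite t0 t1.
- by right; rewrite t0 t1.
- by case: ab.
Qed.

Lemma tint_vertex_refl p z : tint p p (inl z) -> p = inl z.
Proof.
case: p => [x /(_ x x erefl erefl) /(ipt_refl IP) -> //|[e t] h].
have e0 : ends (inr (e, t) : T) (end0 e) by exact: edge_end0.
have e1 : ends (inr (e, t) : T) (end1 e) by exact: edge_end1.
have /(ipt_refl IP) z0 := h _ _ e0 e0; have /(ipt_refl IP) z1 := h _ _ e1 e1.
by case: (@edge_neq e); rewrite -z0 -z1.
Qed.

Lemma ends0 e t : ends (inr (e, t) : T) (end0 e).
Proof. exact: edge_end0. Qed.

Lemma ends1 e t : ends (inr (e, t) : T) (end1 e).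
Proof. exact: edge_end1. Qed.

Lemma tint_off e t p r x y : tint p r (inr (e, t)) -> ~ on_edge e p -> ~ on_edge e r ->
  ends p x -> ends r y -> pint x y (end0 e) /\ pint x y (end1 e).
Proof.
move=> h np nr px ry; apply/crosses.
rewrite -(coord_off np px) -(coord_off nr ry).
exact: between_r_inside (coord_off01 np) (coord_off01 nr) h.
Qed.

Lemma off_vertex e x : ~ on_edge e (inl x).
Proof. by move=> []. Qed.

Lemma off_edge e f t : f <> e -> ~ on_edge e (inr (f, t)).
Proof. by move=> fe [u []]. Qed.

(** The edge [f] would have both its ends between [p] and [z], while [z] is
    between [p] and each of the ends. *)
Lemma not_between_vertex_edge p z f t :
  tint p (inr (f, t)) (inl z) -> tint p (inl z) (inr (f, t)) -> False.
Proof.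
move=> h1 h2; case: (pselect (on_edge f p)) => [[u pE]|np].
  subst p; have := h1 _ _ (ends0 f u) (ends0 f t).
  have := h1 _ _ (ends1 f u) (ends1 f t).
  by move=> /(ipt_refl IP) -> /(ipt_refl IP) /esym; exact: edge_neq.
have [x px] := ends_nonempty p.
have [c0 c1] := tint_off h2 np (@off_vertex f z) px erefl.
have d0 := h1 _ _ px (ends0 f t); have d1 := h1 _ _ px (ends1 f t).
apply: (@edge_neq f).
by rewrite -(ipt_anti IP d0 c0); exact: (ipt_anti IP d1 c1).
Qed.

Lemma tint_pretree : interval_pretree tint.
Proof.
split.
- move=> p [z /tint_vertex_refl -> //|[e t]] h.
  case: (pselect (on_edge e p)) => [[u pE]|np].
    move: h; rewrite pE /tint /= eqxx => h; congr (inr (_, _)); apply: val_inj.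
    by apply/eqP; rewrite eq_le; case: h => /andP[-> ->].
  by have := between_r_inside (coord_off01 np) (coord_off01 np) h.
- move=> p r; case: p => [x y z -> _|[e t]]; first exact: lft.
  rewrite /tint /= eqxx /between_r !lexx /= andbT.
  exact/orP/le_total.
- move=> p r [z h x y px ry|[e t] [h|h]]; first by apply: (ipt_sym IP); exact: h.
  + by right.
  + by left.
- move=> p [z|[f t]] [z'|[g t']] h1 h2.
  + have [x px] := ends_nonempty p; congr inl.
    exact: (ipt_anti IP (h1 _ _ px erefl) (h2 _ _ px erefl)).
  + by case: (not_between_vertex_edge h1 h2).
  + by case: (not_between_vertex_edge h2 h1).
  + case: (pselect (f = g)) => [fg|fg].
      subst g; move: h1 h2; rewrite /tint /= !eqxx => h1 h2.
      congr (inr (_, _)); apply: val_inj; move: h1 h2; set a := coord f p.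
      case=> /andP[h1 h2]; case=> /andP[h3 h4]; rewrite /=; lra.
    case: (pselect (on_edge f p)) => [[u pf]|npf].
      subst p; have := between_r_inside (coord_off01 (off_edge fg))
        (coord_off01 (off_edge fg)) h2.
      by rewrite /= !(introF eqP fg).
    case: (pselect (on_edge g p)) => [[u pg]|npg].
      subst p; have := between_r_inside (coord_off01 (off_edge (nesym fg)))
        (coord_off01 (off_edge (nesym fg))) h1.
      by rewrite /= !(introF eqP (nesym fg)).
    have [x px] := ends_nonempty p.
    have F := tint_off h1 npf (off_edge (nesym fg)) px.
    have G := tint_off h2 npg (off_edge fg) px.
    have f0 := F _ (ends0 g t'); have f1 := F _ (ends1 g t').
    have g0 := G _ (ends0 f t); have g1 := G _ (ends1 f t).
    case: (@edge_neq g); transitivity (end0 f).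
      by rewrite (ipt_anti IP f0.1 g0.1).
    exact: (ipt_anti IP f1.1 g0.2).
- move=> p s r [z h|[e t]].
    apply: contrapT => /not_orP[n1 n2].
    move/existsNP: n1 => [x /existsNP[y /not_implyP[px /not_implyP[sy nxy]]]].
    move/existsNP: n2 => [y' /existsNP[w /not_implyP[sy' /not_implyP[rw nyw]]]].
    have yy' : pint y y' z.
      case: (ipt_cover IP y (h _ _ px rw)) => // yw.
      by case: (ipt_cover IP y' yw).
    have [zy|zy'] : z = y \/ z = y'.
      case: s sy sy' => [v /= vy vy'|[e t]].
        by left; rewrite vy vy' in yy' *; exact: (ipt_refl IP).
      move=> /edge_ends [] ye /edge_ends [] y'e; subst y y'.
      + by left; exact: (ipt_refl IP).
      + exact: edge_pint.
      + by have [] := edge_pint (ipt_sym IP yy'); [right|left].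
      + by left; exact: (ipt_refl IP).
    + by apply: nxy; rewrite zy; exact: rgt.
    + by apply: nyw; rewrite zy'; exact: lft.
  rewrite /tint /=; set a := coord e p; set b := coord e s; set c := coord e r.
  case=> /andP[h h']; case: (leP (\val t) b) => [tb|/ltW bt].
  + by left; left; rewrite h tb.
  + by right; left; rewrite h' bt.
  + by right; right; rewrite h tb.
  + by left; right; rewrite h' bt.
Qed.


(** * Routes and the topology of the tree *)

Lemma vertex_coord_inj e u v : \val e u -> \val e v ->
  vertex_coord e u = vertex_coord e v -> u = v.
Proof.
move=> /edge_ends [] -> /edge_ends [] -> //; rewrite vertex_coord_end0 vertex_coord_end1.
  by move=> /eqP; rewrite eq_sym oner_eq0.
by move=> /eqP; rewrite oner_eq0.
Qed.

Lemma vertex_coord_gate e u x : \val e u -> vertex_coord e x = vertex_coord e u ->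
  forall y, \val e y -> pint x y u.
Proof.
move=> /edge_ends [] ->.
  rewrite vertex_coord_end0 => /vertex_coord0 h y /edge_ends [] -> //; exact: rgt.
rewrite vertex_coord_end1 => /vertex_coord1 h y /edge_ends [] -> //; exact: rgt.
Qed.

Lemma coord_end e p : ~ on_edge e p ->
  exists2 u, \val e u & vertex_coord e u = coord e p.
Proof.
move=> /coord_off01 [] ->.
  by exists (end0 e); [apply/edge_ends; left|exact: vertex_coord_end0].
by exists (end1 e); [apply/edge_ends; right|exact: vertex_coord_end1].
Qed.

Definition same_edge p r := exists e, on_edge e p /\ on_edge e r.

Lemma gate_exists p r : ~ same_edge p r -> exists u, gate p r u.
Proof.
case: p => [x _|[e t] pr].
  by exists x; split=> // x' w -> _; exact: rgt.
have nr : ~ on_edge e r by move=> h; apply: pr; exists e; split=> //; exists t.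
have [u eu cu] := coord_end nr; exists u; split=> // x w ex rw.
apply: (@vertex_coord_gate e) => //.
by rewrite cu (coord_off nr rw).
Qed.

Lemma gate_coord e t r u : ~ on_edge e r -> gate (inr (e, t)) r u ->
  vertex_coord e u = coord e r.
Proof.
move=> nr [/= eu hu]; have [v ev cv] := coord_end nr.
have [w rw] := ends_nonempty r; rewrite -cv.
case: (pselect (u = v)) => [-> //|uv].
have /(_ v ev) h : forall y, \val e y -> pint w y v.
  by apply: (@vertex_coord_gate e) => //; rewrite cv (coord_off nr rw).
have h' := vertex_coord_gate ev (esym (etrans cv (coord_off nr rw))) eu.
by case: uv; exact: (ipt_anti IP (hu v w ev rw) h').
Qed.

Lemma stub_between e t u i : \val e u -> i <> t ->
  stub (inr (e, t)) u (inr (e, i)) <->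
  between_r (\val t) (\val i) (vertex_coord e u).
Proof.
move=> eu it; have /andP[i0 i1] := unit_itvP i.
have vit : \val i != \val t by apply/eqP => /val_inj.
split.
  move=> [j [<-]] [[-> h]|[-> h]].
    by rewrite vertex_coord_end0; right; rewrite !ltW.
  by rewrite vertex_coord_end1; left; rewrite !ltW.
move=> h; exists i => //; case/edge_ends: eu h => ->.
  rewrite vertex_coord_end0 => -[] /andP[h h']; first by rewrite ltNge h' in i0.
  by left; split=> //; rewrite lt_neqAle vit h'.
rewrite vertex_coord_end1 => -[] /andP[h h']; last by rewrite ltNge h in i1.
by right; split=> //; rewrite lt_neqAle eq_sym vit h.
Qed.

Lemma stub_off e p u i : ~ on_edge e p -> ~ stub p u (inr (e, i)).
Proof.
case: p => [x _ []|[f t] np [j [ef _] _]].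
by apply: np; exists t; rewrite ef.
Qed.

Lemma gate_ends p r u : gate p r u -> ends p u.
Proof. by case. Qed.

(** The stub of [p] is the part of its edge between [p] and the coordinate of
    the gate, which is the retraction of [r] by [gate_coord]. *)
Lemma route_set_tint p q r u v : ~ same_edge p r -> q <> p -> q <> r ->
  gate p r u -> gate r p v ->
  (stub p u `|` vertex_citv u v `|` stub r v) q <-> tint p r q.
Proof.
move=> pr qp qr gu gv; have pu := gate_ends gu; have rv := gate_ends gv.
case: q qp qr => [z|[f i]] qp qr.
  split=> [|h]; last first.
    by left; right => z' ->; exact: h.
  move=> h x w px rw.
  have {}h : pint u v z.
    case: h => [[|h]|]; [|exact: h|].
      by case: p {px pr qp gu gv pu} => [y []|[e t] []].
    by case: r {rw pr qr gu gv rv} => [y []|[e t] []].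
  have hu : pint x w u by apply: (ipt_sym IP); exact: gu.2.
  have hv : pint x w v by exact: gv.2.
  exact: (ipt_convex IP hu hv).
have citvE : vertex_citv u v (inr (f, i)) <-> vertex_coord f u <> vertex_coord f v.
  rewrite crosses; split=> [h|[h0 h1] z /edge_ends [] -> //].
  by split; apply: h; [exact: ends0|exact: ends1].
case: (pselect (on_edge f p)) => [[t pE]|np].
  subst p; have nr : ~ on_edge f r by move=> h; apply: pr; exists f; split=> //; exists t.
  have it : i <> t by move=> it; apply: qp; rewrite it.
  have cu := gate_coord nr gu; have cv := coord_off nr rv.
  rewrite /tint /= eqxx -cu -(stub_between pu it); split=> [|h]; last by left; left.
  case=> [[//|/citvE]|/(stub_off nr) //].
  by rewrite cu cv.
case: (pselect (on_edge f r)) => [[t rE]|nr].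
  subst r; have it : i <> t by move=> it; apply: qr; rewrite it.
  have cv := gate_coord np gv; have cu := coord_off np pu.
  have -> : tint p (inr (f, t)) (inr (f, i)) <->
      between_r (\val t) (\val i) (vertex_coord f v).
    rewrite /tint /= eqxx -cv /between_r; split; by case; [right|left].
  rewrite -(stub_between rv it); split=> [|h]; last by right.
  case=> [[/(stub_off np) //|/citvE]|//].
  by rewrite cv cu.
rewrite /tint /= (coord_off np pu) (coord_off nr rv); split.
  case=> [[/(stub_off np) //|/citvE]|/(stub_off nr) //].
  by apply: between_r_01; exact: vertex_coord01.
move=> h; left; right; apply/citvE.
by apply: between_r_inside h; exact: vertex_coord01.
Qed.

Lemma route_tint p q r : ~ same_edge p r ->
  route p q r <-> [/\ q <> p, q <> r & tint p r q].
Proof.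
move=> pr; split=> [[qp qr [u [v [gu gv h]]]]|[qp qr h]].
  by split=> //; exact: (route_set_tint pr qp qr gu gv).1.
split=> //; have [u gu] := gate_exists pr.
have [|v gv] := @gate_exists r p.
  by move=> [e [re pe]]; apply: pr; exists e.
by exists u, v; split=> //; exact: (route_set_tint pr qp qr gu gv).2.
Qed.

Lemma tbetween_tint p q r : tbetween p q r <-> [/\ q <> p, q <> r & tint p r q].
Proof.
case: p r => [x|[e s]] [y|[f t]]; try by apply: route_tint => -[g [[? ?] [? ?]]].
rewrite /tbetween; case: eqP => [<-|ef]; last first.
  by apply: route_tint => -[g [[? [<- _]] [? [gf _]]]]; apply: ef; rewrite gf.
split.
  move=> [i ->] h; split.
  - by move=> [is_]; move: h; rewrite is_ !ltxx andbF.
  - by move=> [it]; move: h; rewrite it !ltxx andbF.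
  - by rewrite /tint /= !eqxx; case/orP: h => /andP[h h']; [left|right]; rewrite !ltW.
case: q => [z|[g i]] [qs qt h].
  have /(ipt_refl IP) z0 := h _ _ (ends0 e s) (ends0 e t).
  have /(ipt_refl IP) z1 := h _ _ (ends1 e s) (ends1 e t).
  by case: (@edge_neq e); rewrite -z0 -z1.
case: (pselect (g = e)) => [ge|ge]; last first.
  have := between_r_inside (coord_off01 (off_edge (nesym ge)))
    (coord_off01 (off_edge (nesym ge))) h.
  by rewrite /= !(introF eqP (nesym ge)).
subst g; exists i => //.
have is_ : \val i != \val s by apply/eqP => /val_inj e'; apply: qs; rewrite e'.
have it : \val i != \val t by apply/eqP => /val_inj e'; apply: qt; rewrite e'.
move: h; rewrite /tint /= eqxx => -[] /andP[h h']; apply/orP; [left|right].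
  by rewrite !lt_neqAle h h' it eq_sym is_.
by rewrite !lt_neqAle h h' is_ eq_sym it.
Qed.

Lemma tint_citv : pitv_cc (@tbetween R X) = tint.
Proof.
apply/funext => p; apply/funext => r; apply/seteqP; split=> q.
  case=> [[->|->]|/tbetween_tint []//].
    exact: (ipt_left tint_pretree).
  exact: (ipt_right tint_pretree).
move=> h; case: (pselect (q = p)) => [->|qp]; first by left; left.
case: (pselect (q = r)) => [->|qr]; first by left; right.
by right; apply/tbetween_tint.
Qed.

Lemma open_tree_branch s a : open [set t | ~ tint s t a].
Proof.
have -> : [set t | ~ tint s t a] = tree_nbhd s [set a].
  rewrite /tree_nbhd tint_citv; apply/seteqP; split=> t /=.
    by move=> h; apply/seteqP; split=> // b [hb ba]; apply: h; rewrite -ba.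
  by move=> h sta; have : (tint s t `&` [set a]) a by []; rewrite h.
set U := tree_nbhd _ _.
exists [set U]; last by rewrite bigcup_set1.
move=> _ ->; exists [fset U]%fset; last by rewrite set_fset1 bigcap_set1.
by move=> V; rewrite in_fset1 => /eqP ->; apply/mem_set; exists s, [set a].
Qed.

(** Finite intersections of subbasic sets are finite intersections of
    branches. *)
Lemma tree_branch_topology : branch_topology tint.
Proof.
split; first exact: open_tree_branch.
move=> S h oh; apply/continuousP => O [F sF <-].
rewrite preimage_bigcup; apply: bigcup_open => B /sF [G GT <-].
rewrite preimage_bigcap -(setCK (\bigcap_(i in _) _)) setC_bigcap.
apply: closed_openC; apply: closed_bigcup.
  exact: finite_fset.
move=> U /GT /set_mem [s [A [fA ->]]]; apply: open_closedC.
have -> : h @^-1` tree_nbhd s A =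
    ~` \bigcup_(a in A) ~` (h @^-1` [set t | ~ tint s t a]).
  rewrite /tree_nbhd tint_citv; apply/seteqP; split=> x /=.
    move=> e [a Aa na]; apply: na => /= sxa.
    by have : (tint s (h x) `&` A) a by []; rewrite e.
  move=> nx; apply/seteqP; split=> // a [sxa Aa]; apply: nx; exists a => //.
apply: closed_openC; apply: closed_bigcup => // a _.
by apply: open_closedC; exact: oh.
Qed.

(** * Density and completeness of the intervals of the tree *)

Lemma coord_bounds e p : 0 <= coord e p <= 1.
Proof.
case: (pselect (on_edge e p)) => [[t ->]|/coord_off01 [] ->].
- by rewrite coord_on; have /andP[/ltW -> /ltW ->] := unit_itvP t.
- by rewrite lexx ler01.
- by rewrite lexx ler01.
Qed.

Lemma unit_itv_mk (a : R) : 0 < a < 1 -> exists t : unit_itv R, \val t = a.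
Proof.
move=> ha; have h : `]0, 1[%classic a by rewrite /= in_itv.
by exists (SigSub (mem_set h)).
Qed.

Lemma coord_neq_on e t q : inr (e, t) <> q -> coord e q <> \val t.
Proof.
move=> tq; case: (pselect (on_edge e q)) => [[u qE]|/coord_off01 h].
  by move: tq; rewrite qE coord_on => tq /val_inj ut; apply: tq; rewrite ut.
by have /andP[t0 t1] := unit_itvP t => e'; case: h => h; rewrite -e' h ?ltxx in t0 t1.
Qed.

Lemma tint_dense : interval_dense tint.
Proof.
have edge_case e i q : inr (e, i) <> q ->
    exists r, [/\ tint (inr (e, i)) q r, r <> inr (e, i) & r <> q].
  move=> sq; have nsq := coord_neq_on sq.
  have /andP[s0 s1] := unit_itvP i; have /andP[c0 c1] := coord_bounds e q.
  have [t tE] : exists t : unit_itv R, \val t = (\val i + coord e q) / 2.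
    by apply: unit_itv_mk; apply/andP; split; lra.
  have ts : \val t <> \val i by move=> ts; apply: nsq; lra.
  have tq : \val t <> coord e q by move=> tq; apply: nsq; lra.
  exists (inr (e, t)); split.
  - suff h : between_r (\val i) (\val t) (coord e q) by rewrite /tint /= eqxx.
    rewrite tE; case: (leP (\val i) (coord e q)) => h; [left|right];
    by apply/andP; split; lra.
  - by move=> [ts']; apply: ts; rewrite ts'.
  - by move=> tq'; apply: tq; rewrite -tq' coord_on.
case=> [x|[e s]] q pq; last exact: edge_case.
case: q pq => [y|[e s]] pq; last first.
  have [r [h r1 r2]] := edge_case e s (inl x) (nesym pq).
  by exists r; split=> //; exact: (ipt_sym tint_pretree).
have xy : x <> y by move=> xy; apply: pq; rewrite xy.
case: (pselect (exists z, [/\ pint x y z, z <> x & z <> y])) => [[z [xyz zx zy]]|nz].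
  exists (inl z); split; last 2 first.
  - by move=> [].
  - by move=> [].
  by move=> x' y' -> ->.
have adj : adjacent_in (@pbetween X) x y.
  split=> //; apply/seteqP; split=> // z xyz; apply: nz; exists z.
  by have [zx zy] := strict xyz; split=> //; right.
have h : [set e : set P | exists xy, adjacent_in pbetween xy.1 xy.2 /\
    e = [set xy.1; xy.2]] [set x; y] by exists (x, y).
pose e : edge X := SigSub (mem_set h).
have ve : \val e = [set x; y] by [].
have [i iE] : exists t : unit_itv R, \val t = 2^-1.
  by apply: unit_itv_mk; apply/andP; split; lra.
exists (inr (e, i)); split=> //.
apply: between_r_01; try exact: vertex_coord01.
apply/crosses; split.
  have : \val e (end0 e) by apply/edge_ends; left.
  by rewrite ve => -[->|->]; [exact: lft|exact: rgt].
have : \val e (end1 e) by apply/edge_ends; right.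
by rewrite ve => -[->|->]; [exact: lft|exact: rgt].
Qed.

(** [p] belongs to the closed edge [e]. *)
Definition in_edge e p := forall x, ends p x -> \val e x.

Lemma in_edge_vertex e x : in_edge e (inl x) <-> \val e x.
Proof. by split=> [|ex y ->//]; exact. Qed.

Lemma in_edge_on e f t : in_edge e (inr (f, t)) -> f = e.
Proof.
move=> h; exact: (edge_eq (edge_end0 f) (h _ (ends0 f t)) (edge_end1 f)
  (h _ (ends1 f t)) (@edge_neq f)).
Qed.

Lemma in_edge_inr e t : in_edge e (inr (e, t)).
Proof. by []. Qed.

Lemma coord_vertex0 e p : in_edge e p -> coord e p = 0 -> p = inl (end0 e).
Proof.
case: p => [x /in_edge_vertex ex /= cx|[f t] /in_edge_on -> c0].
  congr inl; apply: (@vertex_coord_inj e) => //; first by apply/edge_ends; left.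
  by rewrite cx vertex_coord_end0.
by have /andP[] := unit_itvP t; rewrite -(coord_on e) c0 ltxx.
Qed.

Lemma coord_vertex1 e p : in_edge e p -> coord e p = 1 -> p = inl (end1 e).
Proof.
case: p => [x /in_edge_vertex ex /= cx|[f t] /in_edge_on -> c1].
  congr inl; apply: (@vertex_coord_inj e) => //; first by apply/edge_ends; right.
  by rewrite cx vertex_coord_end1.
by have /andP[_] := unit_itvP t; rewrite -(coord_on e) c1 ltxx.
Qed.

Lemma coord_point e (a : R) : 0 <= a <= 1 -> exists p, in_edge e p /\ coord e p = a.
Proof.
case: (eqVneq a 0) => [-> _|a0].
  exists (inl (end0 e)); split; last exact: vertex_coord_end0.
  by apply/in_edge_vertex/edge_ends; left.
case: (eqVneq a 1) => [-> _|a1].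
  exists (inl (end1 e)); split; last exact: vertex_coord_end1.
  by apply/in_edge_vertex/edge_ends; right.
move=> /andP[h h']; have [|t <-] := @unit_itv_mk a.
  by rewrite !lt_neqAle h h' eq_sym a0 a1.
by exists (inr (e, t)); split=> //; exact: coord_on.
Qed.

Lemma ends_other e p u v : in_edge e p -> \val e u -> \val e v -> u <> v ->
  p <> inl u -> ends p v.
Proof.
case: p => [x /in_edge_vertex ex eu ev uv xu|[f t] /in_edge_on -> //].
have xu' : x <> u by move=> e'; apply: xu; rewrite e'.
move: ex eu ev uv xu' => /edge_ends[] -> /edge_ends [] -> /edge_ends [] -> //.
Qed.

Lemma edge_tint_in e p q r : in_edge e p -> in_edge e r -> tint p r q -> in_edge e q.
Proof.
move=> ep er; case: q => [z h|[f t] h].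
  apply/in_edge_vertex; have [x px] := ends_nonempty p; have [y ry] := ends_nonempty r.
  have := h _ _ px ry; have [/edge_ends ex /edge_ends ey] := (ep _ px, er _ ry).
  move=> xyz; apply/edge_ends; apply: edge_pint; apply: (ipt_convex IP) xyz.
    by case: ex => ->; [exact: lft|exact: rgt].
  by case: ey => ->; [exact: lft|exact: rgt].
case: (pselect (f = e)) => [-> //|fe]; exfalso.
have cst p' : in_edge e p' -> ~ on_edge f p' /\ coord f p' = vertex_coord f (end0 e).
  case: p' => [x /in_edge_vertex /edge_ends ex|[g u] /in_edge_on ->].
    split; first exact: off_vertex.
    by case: ex => -> //=; rewrite -vertex_coord_edge //; exact: nesym.
  split; first by apply: off_edge; exact: nesym.
  by rewrite /= (introF eqP (nesym fe)).
have [np cp] := cst p ep; have [nr cr] := cst r er.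
by apply: (between_r_inside (coord_off01 np) (coord_off01 nr) h); rewrite cp cr.
Qed.

Lemma edge_tint_vertex e p r u v : in_edge e p -> in_edge e r -> \val e u -> \val e v ->
  u <> v -> tint p r (inl u) <-> p = inl u \/ r = inl u.
Proof.
move=> ep er eu ev uv; split=> [h|].
  apply: contrapT => /not_orP[pu ru]; apply: (uv).
  apply: (ipt_refl IP); apply: h; first exact: (ends_other ep eu ev uv pu).
  exact: (ends_other er eu ev uv ru).
case=> ->; [exact: (ipt_left tint_pretree)|exact: (ipt_right tint_pretree)].
Qed.

(** The coordinate identifies a closed edge with the unit interval as an ordered
    set. *)
Lemma edge_tint e p q r : in_edge e p -> in_edge e q -> in_edge e r ->
  tint p r q <-> between_r (coord e p) (coord e q) (coord e r).
Proof.
move=> ep eq er.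
have /andP[p0 p1] := coord_bounds e p; have /andP[r0 r1] := coord_bounds e r.
have e0 : \val e (end0 e) by apply/edge_ends; left.
have e1 : \val e (end1 e) by apply/edge_ends; right.
case: q eq => [z /in_edge_vertex /edge_ends ez|[f t] /in_edge_on ->]; last first.
  by rewrite /tint /= eqxx.
case: ez => ->.
  rewrite (edge_tint_vertex ep er e0 e1 (@edge_neq e)) /= vertex_coord_end0; split.
    by case=> ->; rewrite /= vertex_coord_end0; [left|right]; rewrite lexx.
  case=> /andP[h h']; [left|right]; apply: coord_vertex0 => //.
    by apply/eqP; rewrite eq_le h p0.
  by apply/eqP; rewrite eq_le h r0.
rewrite (edge_tint_vertex ep er e1 e0 (nesym (@edge_neq e))) /= vertex_coord_end1; split.
  by case=> ->; rewrite /= vertex_coord_end1; [right|left]; rewrite lexx ?andbT.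
case=> /andP[h h']; [right|left]; apply: coord_vertex1 => //.
  by apply/eqP; rewrite eq_le h' r1.
by apply/eqP; rewrite eq_le h' p1.
Qed.

Lemma edge_complete e p q : in_edge e p -> in_edge e q -> interval_complete tint p q.
Proof.
wlog pq : p q / coord e p <= coord e q.
  move=> H ep eq; case: (leP (coord e p) (coord e q)) => h; first exact: H.
  by apply: (interval_complete_sym tint_pretree); apply: H => //; exact: ltW.
move=> ep eq L iL Lp Lq.
have inE_ s : tint p q s -> in_edge e s by exact: edge_tint_in.
have itv s : tint p q s -> coord e p <= coord e s <= coord e q.
  move=> pqs; have /(edge_tint ep (inE_ s pqs) eq) [//|/andP[h h']] := pqs.
  by rewrite (le_trans pq h) (le_trans h' pq).
pose S := [set a | exists2 s, tint p q s /\ L s & coord e s = a].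
have Sp : S (coord e p) by exists p => //; split=> //; exact: (ipt_left tint_pretree).
have ubS : ubound S (coord e q) by move=> a [s [pqs _] <-]; have /andP[] := itv s pqs.
have hS : has_sup S by split; [exists (coord e p)|exists (coord e q)].
have ps : coord e p <= sup S by exact: (ub_le_sup hS.2).
have sq : sup S <= coord e q by apply: ge_sup => //; exists (coord e p).
(* the supremum of the coordinates is the coordinate of a point of the edge *)
have [m [em cm]] : exists p, in_edge e p /\ coord e p = sup S.
  apply: coord_point; have /andP[p0 _] := coord_bounds e p.
  have /andP[_ q1] := coord_bounds e q.
  by rewrite (le_trans p0 ps) (le_trans sq q1).
exists m; split; first by apply/(edge_tint ep em eq); left; rewrite cm ps sq.
move=> t pqt; have et := inE_ t pqt; have /andP[pt tq] := itv t pqt; split=> Lt.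
  apply/(edge_tint ep et em); left; rewrite pt cm.
  by apply: (ub_le_sup hS.2); exists t.
apply/(edge_tint ep em et); left; rewrite cm ps.
apply: ge_sup; first by exists (coord e p).
move=> a [s [pqs Ls] <-]; rewrite leNgt; apply/negP => ts.
apply: Lt; apply: (iL s t pqs Ls); apply/(edge_tint ep et (inE_ s pqs)).
by left; rewrite pt ltW.
Qed.

Hypothesis complete : forall x y, interval_complete (@pint X) x y.

Lemma tint_vertex x y z : tint (inl x) (inl y) (inl z) <-> pint x y z.
Proof. by split=> [|h x' y' -> ->//]; exact. Qed.

(** The ends of [f] in the order [u], [v] in which they are met on the way from
    [x] to [y]. *)
Lemma edge_crossing x y f i : tint (inl x) (inl y) (inr (f, i)) -> exists u v,
  [/\ \val f u, \val f v, pint x y u & pint x y v] /\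
  tint (inl x) (inl v) (inr (f, i)) /\ tint (inl x) (inr (f, i)) (inl u).
Proof.
move=> h; have [h0 h1] := tint_off h (@off_vertex f x) (@off_vertex f y) erefl erefl.
have pf u : \val f u -> pint x y u by move=> /edge_ends [] ->.
have [u fu cu] := coord_end (@off_vertex f x).
have [v fv cv] := coord_end (@off_vertex f y).
exists u, v; split; first by split=> //; exact: pf.
split; first by rewrite /tint /= cv.
move=> x' w -> /= fw; exact: (@vertex_coord_gate f).
Qed.

(** The vertices of the cut are filled by a vertex [m]. If [m] does not fill the
    whole cut, an edge point [t] is on the wrong side of [m], and the cut is
    between [t] and an end of its edge. *)
Lemma vertex_complete x y : interval_complete tint (inl x) (inl y).
Proof.
have TP := tint_pretree.
move=> L iL Lx Ly; pose M := [set z | L (inl z)].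
have [||//|m [xym cm]] := @complete x y M.
- move=> t s xyt Lt xts; apply: (iL (inl t)) => //; exact/tint_vertex.
- by [].
have xym' : tint (inl x) (inl y) (inl m) by exact/tint_vertex.
apply: contrapT => nocut; apply: (nocut); exists (inl m); split=> // t xyt.
case: t xyt => [z /tint_vertex xyz|[f i] xyt].
  by have [c1 c2] := cm z xyz; split=> Lz; apply/tint_vertex; [exact: c1|exact: c2].
have [u [v [[fu fv xyu xyv] [xvt xtu]]]] := edge_crossing xyt.
have xyu' : tint (inl x) (inl y) (inl u) by exact/tint_vertex.
have xyv' : tint (inl x) (inl y) (inl v) by exact/tint_vertex.
split=> Lt; apply: contrapT => nt; apply: nocut.
  have Lv : ~ L (inl v).
    move=> Lv; apply: nt; have /tint_vertex xmv := (cm v xyv).1 Lv.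
    exact: (ipt_sub TP xmv).
  have fv' : in_edge f (inl v) by exact/in_edge_vertex.
  have iL' := initial_segment_sub TP xyv' xvt iL.
  have [k ck] := edge_complete (@in_edge_inr f i) fv' iL' Lt Lv.
  by exists k; exact: (interval_cut_local TP iL xyv' xvt).
have Lu : L (inl u).
  apply: contrapT => Lu; apply: nt; have /tint_vertex xum := (cm u xyu).2 Lu.
  exact: (ipt_sub TP xtu).
have fu' : in_edge f (inl u) by exact/in_edge_vertex.
have iL' := initial_segment_sub TP xyt xtu iL.
have [k ck] := edge_complete fu' (@in_edge_inr f i) iL' Lu Lt.
by exists k; exact: (interval_cut_local TP iL xyt xtu).
Qed.

Lemma tint_gate e t q : ~ on_edge e q ->
  exists2 u, \val e u & tint (inr (e, t)) q (inl u).
Proof.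
move=> nq; have [u eu cu] := coord_end nq; exists u => // x y ex qy.
apply: (ipt_sym IP); apply: (@vertex_coord_gate e) => //.
by rewrite cu (coord_off nq qy).
Qed.

Lemma tint_complete p q : interval_complete tint p q.
Proof.
have TP := tint_pretree.
have off x p' : interval_complete tint p' (inl x).
  case: p' => [y|[e t]]; first exact: vertex_complete.
  have [u eu hu] := tint_gate t (@off_vertex e x).
  apply: (interval_complete_glue TP hu); last exact: vertex_complete.
  by apply: (@edge_complete e) => //; exact/in_edge_vertex.
case: p => [x|[e t]]; first by apply: (interval_complete_sym TP); exact: off.
case: (pselect (on_edge e q)) => [[u ->]|nq]; first exact: (@edge_complete e).
have [u eu hu] := tint_gate t nq.
apply: (interval_complete_glue TP hu); first exact: off.
by apply: (interval_complete_sym TP); exact: off.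
Qed.

(** * Separability of the intervals of the tree *)

Hypothesis dense_vertices : forall x y, exists2 Q : set P, countable Q &
  forall u v, pint x y u -> pint x y v -> u <> v -> pint u v `&` Q !=set0.

Definition crossed x y := [set f | pint x y (end0 f) /\ pint x y (end1 f)].

(** The end of [f] that is closest to [x]. *)
Definition first_end x f := if `[< pint x (end1 f) (end0 f) >] then end0 f else end1 f.

Lemma first_endP x y f : crossed x y f ->
  \val f (first_end x f) /\ forall u, \val f u -> pint x u (first_end x f).
Proof.
move=> [h0 h1]; rewrite /first_end; case: asboolP => h; split.
- exact: edge_end0.
- by move=> u /edge_ends[] ->.
- exact: edge_end1.
- by move=> u /edge_ends[] ->; first by case: (ipt_total IP h0 h1).
Qed.

(** Each edge between [x] and [y] has an end in a countable set, by separability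
    of the pretree, and it is determined by this end and by its being the first
    or the last one. *)
Lemma countable_crossed x y : countable (crossed x y).
Proof.
have [Q cQ hQ] := dense_vertices x y.
have [phi phiI] := countable_injP _ cQ.
have crossedE a b f u : crossed a b f -> \val f u -> pint a b u.
  by move=> [h0 h1] /edge_ends[] ->.
have half_countable a b : countable [set f | crossed a b f /\ Q (first_end a f)].
  apply/countable_injP; exists (fun f => phi (first_end a f)).
  move=> f g /set_mem [cf Qf] /set_mem [cg Qg].
  move=> /phiI; rewrite !inE => /(_ Qf Qg) fg.
  have [ff af] := first_endP cf; have [gg ag] := first_endP cg.
  apply: contrapT => nfg; have other h : exists v, \val h v /\ v <> first_end a h.
    rewrite /first_end; case: asboolP => _.
      by exists (end1 h); split; [exact: edge_end1|exact/nesym/edge_neq].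
    by exists (end0 h); split; [exact: edge_end0|exact: edge_neq].
  have [v [fv vf]] := other f; have [w [gw wg]] := other g.
  (* v' is the other end of f', and it lies on g' since it comes before w' *)
  have key f' g' v' w' : first_end a f' = first_end a g' -> \val f' (first_end a f') ->
      \val g' (first_end a g') -> \val f' v' -> \val g' w' -> v' <> first_end a f' ->
      pint a v' (first_end a f') -> pint a w' v' -> f' = g'.
    move=> e ff' gg' fv' gw' vf' av' wv'; rewrite -e in gg'.
    have : pint (first_end a f') w' v' by exact: (ipt_swap IP wv' av').
    have gvw z : pint (first_end a f') w' z -> \val g' z.
      move=> h; apply/edge_ends; apply: edge_pint; apply: (ipt_convex IP) h.
        by case/edge_ends: gg' => ->.
      by case/edge_ends: gw' => ->.
    by move=> /gvw gv'; exact: (edge_eq ff' gg' fv' gv' (nesym vf')).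
  apply: nfg.
  have pfv := crossedE _ _ _ _ cf fv; have pgw := crossedE _ _ _ _ cg gw.
  case: (ipt_total IP pfv pgw) => h.
    by apply/esym; apply: (key g f w v) => //; exact: ag.
  by apply: (key f g v w) => //; exact: af.
have sub : crossed x y `<=` [set f | crossed x y f /\ Q (first_end x f)] `|`
    [set f | crossed y x f /\ Q (first_end y f)].
  move=> f cf; have cf' : crossed y x f.
    by case: cf => h0 h1; split; exact: (ipt_sym IP).
  have [fx hx] := first_endP cf; have [fy hy] := first_endP cf'.
  have neq : first_end x f <> first_end y f.
    move=> e; have key u : \val f u -> u = first_end x f.
      move=> fu; have xu := hx u fu; have := hy u fu; rewrite -e => yu.
      have yfu := ipt_sym IP (ipt_swap IP (crossedE _ _ _ _ cf fu) xu).
      exact: (ipt_anti IP yfu yu).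
    by apply: (@edge_neq f); rewrite (key _ (edge_end0 f)) (key _ (edge_end1 f)).
  have [q [hq Qq]] := hQ _ _ (crossedE _ _ _ _ cf fx) (crossedE _ _ _ _ cf fy) neq.
  have /edge_ends fq : q = end0 f \/ q = end1 f.
    apply: edge_pint; apply: (ipt_convex IP) hq.
      by case/edge_ends: fx => ->.
    by case/edge_ends: fy => ->.
  have := edge_set fx fy neq; move: fq => /[swap] -> [] qE; [left|right];
    by split=> //; rewrite -qE.
apply: sub_countable (subset_card_le sub) _.
by apply: countable_setU; exact: half_countable.
Qed.

Lemma rat_between (a c : R) : 0 < a -> a < 1 -> 0 <= c -> c <= 1 -> a <> c ->
  exists2 k : rat, 0 < (ratr k : R) < 1 & between_r a (ratr k) c.
Proof.
move=> a0 a1 c0 c1 ac; case: (ltgtP a c) => [h|h|//].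
  have [k] := rat_in_itvoo h; rewrite in_itv /= => /andP[ik kc].
  by exists k; [apply/andP; split; lra|left; rewrite !ltW].
have [k] := rat_in_itvoo h; rewrite in_itv /= => /andP[ik kc].
by exists k; [apply/andP; split; lra|right; rewrite !ltW].
Qed.

Lemma tint_separable : interval_separable tint.
Proof.
move=> p q; have [x px] := ends_nonempty p; have [y qy] := ends_nonempty q.
have [Q cQ hQ] := dense_vertices x y.
pose E := crossed x y `|` ([set f | on_edge f p] `|` [set f | on_edge f q]).
pose Rat := [set t : unit_itv R | range ratr (\val t)].
pose D := (inl @` Q : set T) `|` [set (inr a : T) | a in E `*` Rat].
have c_on r : countable [set f | on_edge f r].
  case: r => [z|[f t]].
    by rewrite (_ : [set f | _] = set0) //; apply/seteqP; split=> // f [].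
  apply: (@sub_countable _ _ _ [set f]) => //; apply: subset_card_le => g [t' [-> _]].
  by [].
have cE : countable E.
  apply: countable_setU; first exact: countable_crossed.
  by apply: countable_setU; exact: c_on.
have cRat : countable Rat.
  apply: (@countable_preimage _ _ val (range ratr)); last exact: val_inj.
  exact: card_le_trans (card_image_le _ _) (countableP _).
have cD : countable D.
  apply: countable_setU; first exact: card_le_trans (card_image_le _ _) cQ.
  apply: card_le_trans (card_image_le _ _) _; exact: countableX.
exists D => //.
have TP := tint_pretree.
have edge_case f i r : tint p q (inr (f, i)) -> inr (f, i) <> r ->
    tint (inr (f, i)) r `&` D !=set0.
  move=> pqf fr; have nfr := coord_neq_on fr.
  have Ef : E f.
    case: (pselect (on_edge f p)) => [hp|np]; first by right; left.
    case: (pselect (on_edge f q)) => [hq|nq]; first by right; right.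
    by left; have [] := tint_off pqf np nq px qy.
  have /andP[i0 i1] := unit_itvP i; have /andP[c0 c1] := coord_bounds f r.
  have [k k01 kb] := rat_between i0 i1 c0 c1 (nesym nfr).
  have [t tk] := unit_itv_mk k01.
  exists (inr (f, t)); split; first by rewrite -tk in kb; rewrite /tint /= eqxx.
  by right; exists (f, t) => //; split=> //; exists k.
case=> [z|[f i]] [z'|[g j]] pqs pqt st; try exact: edge_case.
  have xyz := pqs _ _ px qy; have xyz' := pqt _ _ px qy.
  have zz' : z <> z' by move=> e; apply: st; rewrite e.
  have [w [zw Qw]] := hQ _ _ xyz xyz' zz'.
  by exists (inl w); split; [exact/tint_vertex|left; exists w].
have [r [h Dr]] := edge_case g j (inl z) pqt (nesym st).
by exists r; split=> //; exact: (ipt_sym TP).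
Qed.

Lemma tree_real : real_tree T.
Proof.
apply: (interval_real_tree tint_pretree tree_branch_topology tint_dense tint_complete).
exact: tint_separable.
Qed.

End Tree.

Theorem theorem13 (R : realType) (X : metricType R)
  (compactX : compact [set: X]) (connectedX : connected [set: X]) :
  preseparable (@pbetween X) /\ real_tree (cut_tree R X).
Proof.
split; first exact: pretree_preseparable.
have hX : hausdorff_space X := @metric_hausdorff R X.
apply: tree_real.
- exact: pint_pretree.
- move=> x z y; have [a ->] := clsP x; have [b ->] := clsP y; have [c ->] := clsP z.
  by move=> /(pbetween_cls hX)[].
- exact: pretree_median.
- exact: pretree_complete.
- exact: dense_cuts.
Qed.
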